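(* Let $m\ge 3$, let $K$ be a field, and let $\Delta_s(\mathcal{J}_{2,m})$ be the spanning simplicial complex of the Jahangir graph $\mathcal{J}_{2,m}$. Then the face ring $K[\Delta_s(\mathcal{J}_{2,m})]$ is Cohen-Macaulay.
   Context: Jahangir graph: for $m\ge 3$, $\mathcal{J}_{2,m}$ is the graph on $2m+1$ vertices consisting of a cycle of length $2m$ and one additional vertex adjacent to $m$ vertices of that cycle, consecutive ones being at distance $2$ on the cycle. Spanning simplicial complex: for a finite simple connected graph $G$ with edge set $E$, $s(G)$ is the set of edge sets of all spanning trees of $G$, and $\Delta_s(G)$ is the simplicial complex on $E$ whose facets are precisely the elements of $s(G)$. Face ring: for a simplicial complex $\Delta$ on a finite vertex set, $K[\Delta]=S/I_{\mathcal N}(\Delta)$, where $S$ is the polynomial ring over $K$ with one variable per vertex and $I_{\mathcal N}(\Delta)$ is the ideal generated by the squarefree monomials corresponding to non-faces of $\Delta$ (Stanley-Reisner ideal). *)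

(* Defs.v *)
From HB Require Import structures.
From mathcomp Require Import all_boot all_algebra ring_quotient.
From mathcomp Require Import boolp mpoly.

Set Implicit Arguments.
Unset Strict Implicit.
Unset Printing Implicit Defensive.

Import GRing.Theory.
Local Open Scope ring_scope.

Section CommutativeAlgebra.

Variable R : comNzRingType.
Implicit Types (I J P M : R -> Prop) (s : seq R).

Definition is_ideal I : Prop :=
  [/\ I 0, forall x y, I x -> I y -> I (x + y) & forall a x, I x -> I (a * x)].

Definition ideal_gen (A : R -> Prop) : R -> Prop :=
  fun x => forall J, is_ideal J -> (forall a, A a -> J a) -> J x.

Definition ideal_seq s : R -> Prop := ideal_gen (fun x => x \in s).

Definition noetherian : Prop :=
  forall I, is_ideal I -> exists s, forall x, I x <-> ideal_seq s x.

Definition prime_ideal P : Prop :=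
  [/\ is_ideal P, ~ P 1 & forall x y, P (x * y) -> P x \/ P y].

Definition maximal_ideal M : Prop :=
  [/\ is_ideal M, ~ M 1
    & forall J, is_ideal J -> (forall x, M x -> J x) -> ~ J 1 ->
      forall x, J x -> M x].

Definition regular_seq s : Prop :=
  (forall i, (i < size s)%N -> forall a,
     ideal_seq (take i s) (s`_i * a) -> ideal_seq (take i s) a)
  /\ ~ ideal_seq s 1.

Definition regular_seq_in I s : Prop :=
  regular_seq s /\ forall x, x \in s -> I x.

Definition has_depth I (n : nat) : Prop :=
  (exists2 s, regular_seq_in I s & size s = n) /\
  (forall s, regular_seq_in I s -> (size s <= n)%N).

(* C 0 < C 1 < ... < C n = P, all of them prime; the values of C beyond n are
   irrelevant. *)
Definition prime_chain_to P (n : nat) (C : nat -> R -> Prop) : Prop :=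
  [/\ forall i, (i <= n)%N -> prime_ideal (C i),
      forall i, (i < n)%N -> forall x, C i x -> C i.+1 x,
      forall i, (i < n)%N -> exists2 x, C i.+1 x & ~ C i x
    & forall x, C n x <-> P x].

Definition has_height P (n : nat) : Prop :=
  (exists C, prime_chain_to P n C) /\
  (forall k C, prime_chain_to P k C -> (k <= n)%N).

(* The definition of Kaplansky (Commutative Rings, Section 3-1) and Eisenbud
   (Commutative Algebra, Section 18.2).  All maximal ideals are considered, not
   only the homogeneous one, and regular sequences need not be homogeneous.  In
   a Noetherian ring, depth and height of M are finite, and they are the depth
   and the dimension of the localization at M. *)
Definition cohen_macaulay : Prop :=
  noetherian /\
  forall M, maximal_ideal M -> exists2 n, has_depth M n & has_height M n.

Lemma ideal_gen_ideal A : is_ideal (ideal_gen A).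
Proof.
split=> [J [] //|x y Ix Iy J IJ AJ|a x Ix J IJ AJ].
  by case: (IJ) => _ addJ _; apply: addJ; [apply: Ix | apply: Iy].
by case: (IJ) => _ _ mulJ; apply: mulJ; apply: Ix.
Qed.

End CommutativeAlgebra.

Arguments cohen_macaulay : clear implicits.

Record scomplex (V : finType) := SComplex {
  face : {set V} -> Prop;
  face0 : face set0;
  face_sub : forall A B : {set V}, A \subset B -> face B -> face A
}.

Section FaceRing.

Variables (K : fieldType) (V : finType) (D : scomplex V).

(* The variable attached to the vertex v is 'X_(enum_rank v). *)
Definition sqfree_monomial (F : {set V}) : {mpoly K[#|V|]} :=
  \prod_(v in F) 'X_(enum_rank v).

Definition nonface_monomial (p : {mpoly K[#|V|]}) : Prop :=
  exists2 F, ~ face D F & p = sqfree_monomial F.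

Definition SR_ideal (p : {mpoly K[#|V|]}) : bool :=
  `[< ideal_gen nonface_monomial p >].

Lemma SR_ideal_proper : ~ ideal_gen nonface_monomial 1.
Proof.
pose J (p : {mpoly K[#|V|]}) := p.@[fun=> 0 : K] = 0 :> K.
move=> gen1; suff /eqP : J 1 by rewrite rmorph1 oner_eq0.
apply: gen1; rewrite /J.
  split=> [|x y x0 y0|a x x0]; first by rewrite rmorph0.
    by rewrite rmorphD /= x0 y0 addr0.
  by rewrite rmorphM /= x0 mulr0.
move=> _ [F nF ->]; have [F0|[v Fv]] := set_0Vmem F.
  by case: nF; rewrite F0; apply: face0.
by rewrite /sqfree_monomial (bigD1 v) //= rmorphM /= mevalXU mul0r.
Qed.

Lemma SR_ideal_closed : idealr_closed SR_ideal.
Proof.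
have [I0 ID IM] := ideal_gen_ideal nonface_monomial.
split; rewrite ?unfold_in; [exact/asboolP | exact/asboolP/SR_ideal_proper |].
move=> a x y /asboolP Ix /asboolP Iy; apply/asboolP; apply: ID => //; exact: IM.
Qed.

HB.instance Definition _ :=
  isIdealr.Build {mpoly K[#|V|]} SR_ideal SR_ideal_closed.

Definition face_ring : comNzRingType := {ideal_quot (Idealr.clone _ SR_ideal _)}.

End FaceRing.

Record connected_graph (V : finType) := ConnectedGraph {
  adj : rel V;
  adj_sym : ssrbool.symmetric adj;
  adj_irrefl : irreflexive adj;
  adj_connected : forall x y, connect adj x y
}.

Section SpanningComplex.

Variables (V : finType) (G : connected_graph V).

Definition edge_set : {set {set V}} :=
  [set e | [exists x, exists y, adj G x y && (e == [set x; y])]].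

Definition edge : finType := {e : {set V} | e \in edge_set}.

Implicit Type T : {set edge}.

Definition subadj T : rel V :=
  fun x y => [exists e in T, val e == [set x; y]].

Definition spans T : bool := [forall x, forall y, connect (subadj T) x y].

Definition acyclic T : Prop :=
  forall c : seq V, (2 < size c)%N -> ~ ucycle (subadj T) c.

Definition spanning_tree T : Prop := spans T /\ acyclic T.

(* All spanning trees have the same number of edges, so the inclusion-maximal
   sets among these are exactly the spanning trees. *)
Definition spanning_face (F : {set edge}) : Prop :=
  exists2 T, spanning_tree T & F \subset T.

Lemma subadj_sym T : ssrbool.symmetric (subadj T).
Proof. by move=> x y; rewrite /subadj setUC. Qed.

Lemma spans_setT : spans [set: edge].
Proof.
apply/forallP=> x; apply/forallP=> y.
apply: connect_sub (adj_connected G x y) => u v uv; apply: connect1.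
have uvE : [set u; v] \in edge_set.
  by rewrite inE; apply/existsP; exists u; apply/existsP; exists v; rewrite uv /=.
by apply/existsP; exists (Sub [set u; v] uvE); rewrite inE SubK eqxx.
Qed.

Lemma minset_acyclic T : minset spans T -> acyclic T.
Proof.
move=> /minsetP[spT minT] [|x [|y [|z q]]] // _ /andP[].
rewrite /= => /and3P[xy yz zq] /and4P[].
rewrite !inE !negb_or => /and3P[xNy xNz xq] /andP[yNz yq] _ _.
have [e0 /andP[e0T /eqP e0E]] := existsP xy.
pose T' := T :\ e0.
have avoid u v : subadj T u v -> [set u; v] != [set x; y] -> subadj T' u v.
  move=> /existsP[e /andP[eT /eqP eE]] uvN; apply/existsP; exists e.
  rewrite !inE eT eE eqxx !andbT; apply: contraNneq uvN => ee0.
  by rewrite -eE ee0 e0E.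
have yx : connect (subadj T') y x.
  apply/connectP; exists (z :: rcons q x); last by rewrite /= last_rcons.
  rewrite /= avoid //=; last first.
    apply: contraNneq xNz => /setP/(_ x); rewrite !inE eqxx (negPf xNy) /=.
    by move=> ->.
  have: all (predC1 y) (z :: rcons q x).
    rewrite /= eq_sym yNz all_rcons /= xNy; apply/allP=> w wq /=.
    by apply: contraNneq yq => <-.
  move=> ally; apply: (sub_in_path _ ally zq) => u v uNy vNy uv.
  apply: avoid => //; rewrite !inE in uNy vNy.
  apply/eqP=> /setP/(_ y).
  by rewrite !inE eqxx orbT eq_sym (negPf uNy) eq_sym (negPf vNy).
have csym : connect_sym (subadj T') by apply/sym_connect_sym/subadj_sym.
have spT' : spans T'.
  apply/forallP=> u; apply/forallP=> v.
  apply: connect_sub (forallP (forallP spT u) v) => a b ab.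
  have [abE|] := eqVneq [set a; b] [set x; y]; last first.
    by move=> abN; apply/connect1/avoid.
  have: a \in [set x; y] by rewrite -abE !inE eqxx.
  have: b \in [set x; y] by rewrite -abE !inE eqxx orbT.
  rewrite !inE => /orP[]/eqP-> /orP[]/eqP->; rewrite ?connect0 //.
  by rewrite csym.
have /setP/(_ e0) := minT _ spT' (subD1set _ _).
by rewrite !inE eqxx e0T.
Qed.

Lemma spanning_face0 : spanning_face set0.
Proof.
have [T minT] := ex_minset (ex_intro spans _ spans_setT).
exists T; last exact: sub0set.
by split; [case/minsetP: minT | apply: minset_acyclic].
Qed.

Lemma spanning_face_sub (A B : {set edge}) :
  A \subset B -> spanning_face B -> spanning_face A.
Proof. by move=> AB [T tT BT]; exists T => //; apply: subset_trans BT. Qed.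

Definition spanning_complex : scomplex edge :=
  SComplex spanning_face0 spanning_face_sub.

End SpanningComplex.

Section Jahangir.

Variable m : nat.

(* [None] is the additional vertex, [Some i] the i-th vertex of the 2m-cycle,
   and [ordS] is the cyclic successor. *)
Definition jahangir_adj : rel (option 'I_(2 * m)) :=
  fun x y => match x, y with
  | Some i, Some j => (j == ordS i) || (i == ordS j)
  | None, Some i | Some i, None => ~~ odd i
  | None, None => false
  end.

Lemma odd_ordS (i : 'I_(2 * m)) : odd (ordS i) = ~~ odd i.
Proof. by rewrite /= odd_mod // oddM. Qed.

Lemma jahangir_sym : ssrbool.symmetric jahangir_adj.
Proof. by move=> [i|] [j|] //=; rewrite orbC. Qed.

Lemma jahangir_irrefl : irreflexive jahangir_adj.
Proof.
move=> [i|] //=; rewrite orbb; apply/eqP=> iS.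
by have := odd_ordS i; rewrite -iS; case: odd.
Qed.

Lemma jahangir_connected x y : connect jahangir_adj x y.
Proof.
have center i : connect jahangir_adj None (Some i).
  have [iodd|ieven] := boolP (odd i); last exact: connect1.
  apply: (@connect_trans _ _ (Some (ordS i))); apply: connect1.
    by rewrite /jahangir_adj odd_ordS iodd.
  by rewrite /jahangir_adj eqxx orbT.
have csym := sym_connect_sym jahangir_sym.
have toC z : connect jahangir_adj None z by case: z => [i|].
by apply: connect_trans (toC y); rewrite csym.
Qed.

Definition jahangir : connected_graph (option 'I_(2 * m)) :=
  ConnectedGraph jahangir_sym jahangir_irrefl jahangir_connected.

End Jahangir.

(* Main.v *)
Require Import Defs.
From HB Require Import structures.
From mathcomp Require Import all_boot all_algebra ring_quotient.
From mathcomp Require Import boolp mpoly ring.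
From mathcomp Require classical_sets.

(** The faces of the spanning complex of a connected graph are the independent
    sets of a matroid, and the face ring of every matroid complex is
    Cohen-Macaulay; the Jahangir graph is only an instance.

    Write S for the polynomial ring, I for the Stanley-Reisner ideal, R = S/I
    and d for the common size of the bases.  Every maximal ideal M of R has
    depth and height d, for three reasons.

    (1) M contains a regular sequence of length d.  By Zariski's lemma
    [zariski_lemma], M contains a nonzero polynomial p_v(x_v) in each single
    variable, hence z_v = x_v p_v(x_v).  The elementary symmetric functions
    e_d, ..., e_1 of the z_v lie in M and form a regular sequence on S/I
    [elem_sym_weakly_regular].  To see it, pick a variable x that belongs to
    some but not all bases; the exact sequence
        0 -> S/(I : x) -> S/I -> S/(I + (x)) -> 0
    has as outer terms the face rings of two matroids with fewer bases, those
    containing x and those avoiding it, and regular sequences pass to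
    extensions [weakly_regular_extension].  Repeating this, one arrives at a
    single basis F, where S/I is the polynomial ring on F and e_d is the
    product of the z_v, v in F.  Modulo each factor z_v, the remaining
    e_{d-1}, ..., e_1 are the elementary symmetric functions of the others, and
    the product is treated by the same extension argument.  The factor x_v
    in z_v kills the products over non-faces, whatever p_v is; this makes the
    construction work at nonhomogeneous maximal ideals and over finite fields.

    (2) A regular sequence of length k in M yields a chain of primes of length
    k ending at M: a nonzerodivisor mod an ideal can be avoided by a smaller
    prime over that ideal [prime_below_nzd].

    (3) A chain of primes of R has length at most d.  Its smallest member
    contains all variables outside some basis B.  A chain of length k provides
    k elements that are algebraically independent modulo its smallest member,
    and counting monomials of bounded degree gives k <= #|B|
    [prime_chain_bound].

    By (2), all regular sequences in M are as short as the chains of (3), and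
    the sequence of (1) gives a chain of length d.  That R is Noetherian is
    Hilbert's basis theorem [hilbert_basis]. *)

Set Implicit Arguments.
Unset Strict Implicit.
Unset Printing Implicit Defensive.

Import GRing.Theory.
Local Open Scope ring_scope.

(** * Ideals, weakly regular sequences and chains of primes *)

Section Ideals.
Variable R : comNzRingType.
Implicit Types (I J P M : R -> Prop) (s : seq R) (x y z : R).

Lemma ideal0 I : is_ideal I -> I 0. Proof. by case. Qed.
Lemma idealD I x y : is_ideal I -> I x -> I y -> I (x + y).
Proof. by case=> _ + _; apply. Qed.
Lemma ideal_mull I a x : is_ideal I -> I x -> I (a * x).
Proof. by case=> _ _; apply. Qed.
Lemma ideal_mulr I a x : is_ideal I -> I x -> I (x * a).
Proof. by rewrite mulrC; apply: ideal_mull. Qed.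
Lemma idealN I x : is_ideal I -> I x -> I (- x).
Proof. by rewrite -mulN1r; apply: ideal_mull. Qed.
Lemma idealB I x y : is_ideal I -> I x -> I y -> I (x - y).
Proof. by move=> iI Ix Iy; apply: idealD => //; apply: idealN. Qed.
Lemma idealBr I x y : is_ideal I -> I y -> I (x - y) -> I x.
Proof. by move=> iI Iy Ixy; rewrite -[x](subrK y); apply: idealD. Qed.
Lemma ideal_sum I (T : Type) (r : seq T) (Q : pred T) F :
  is_ideal I -> (forall i, Q i -> I (F i)) -> I (\sum_(i <- r | Q i) F i).
Proof.
move=> iI IF; elim/big_rec: _ => [|i x Qi Ix]; first exact: ideal0.
by apply: idealD => //; apply: IF.
Qed.

Lemma ideal_ext I J : (forall x, I x <-> J x) -> I = J.
Proof. by move=> IJ; apply/funext => x; apply/propext. Qed.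

Lemma ideal_gen_sub (A : R -> Prop) I :
  is_ideal I -> (forall a, A a -> I a) -> forall x, ideal_gen A x -> I x.
Proof. by move=> iI AI x; apply. Qed.

Lemma ideal_gen_mem (A : R -> Prop) x : A x -> ideal_gen A x.
Proof. by move=> Ax J _; apply. Qed.

Definition add_gen I y : R -> Prop := fun x => exists a, I (x - a * y).

Lemma add_gen_ideal I y : is_ideal I -> is_ideal (add_gen I y).
Proof.
move=> iI; split.
- by exists 0; rewrite mul0r subr0; apply: ideal0.
- move=> u v [a Ia] [b Ib]; exists (a + b).
  by rewrite mulrDl opprD addrACA; apply: idealD.
- by move=> c u [a Ia]; exists (c * a); rewrite -mulrA -mulrBr; apply: ideal_mull.
Qed.

Lemma add_gen_incl I y x : I x -> add_gen I y x.
Proof. by exists 0; rewrite mul0r subr0. Qed.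

Lemma add_gen_mem I y a : is_ideal I -> add_gen I y (a * y).
Proof. by exists a; rewrite subrr; apply: ideal0. Qed.

Lemma add_gen_self I y : is_ideal I -> add_gen I y y.
Proof. by move=> iI; have := add_gen_mem y 1 iI; rewrite mul1r. Qed.

Lemma add_genC I x y : add_gen (add_gen I x) y = add_gen (add_gen I y) x.
Proof.
by apply: ideal_ext => z; split=> -[a [b]]; rewrite addrAC => Iz; exists b, a.
Qed.

Lemma add_gen_absorb I x : is_ideal I -> I x -> add_gen I x = I.
Proof.
move=> iI Ix; apply: ideal_ext => z; split; last exact: add_gen_incl.
by case=> a; apply: idealBr => //; apply: ideal_mull.
Qed.

Lemma add_gen_congr I x y : is_ideal I -> I (x - y) -> add_gen I x = add_gen I y.
Proof.
move=> iI Ixy; apply: ideal_ext => z; split=> -[a Iz]; exists a.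
  have -> : z - a * y = z - a * x + a * (x - y) by ring.
  by apply: idealD => //; apply: ideal_mull.
have -> : z - a * x = z - a * y - a * (x - y) by ring.
by apply: idealB => //; apply: ideal_mull.
Qed.

Definition colon I x : R -> Prop := fun a => I (x * a).

Definition nzd_mod I y := forall a, I (y * a) -> I a.

(** The final ideal may be the unit ideal, as happens for an empty product in
    [weakly_regular_prod]. *)
Fixpoint weakly_regular I s : Prop :=
  if s is y :: s' then nzd_mod I y /\ weakly_regular (add_gen I y) s' else True.

Lemma weakly_regular_unit I s : is_ideal I -> I 1 -> weakly_regular I s.
Proof.
elim: s I => //= y s IH I iI I1; split.
  by move=> a _; rewrite -[a]mulr1; apply: ideal_mull.
by apply: IH; [apply: add_gen_ideal | apply: add_gen_incl].
Qed.

(** Multiplication by x gives an exact sequence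
    0 -> R/(I : x) -> R/I -> R/(I + (x)) -> 0.  If y is a nonzerodivisor on both
    ends, it is one in the middle, and the sequence stays exact modulo y because
    then (I + (y)) : x = (I : x) + (y). *)
Lemma weakly_regular_extension I x s : is_ideal I ->
  weakly_regular (colon I x) s -> weakly_regular (add_gen I x) s ->
  weakly_regular I s.
Proof.
elim: s I => //= y s IH I iI [nzC wC] [nzA wA]; split.
  move=> a Iya.
  have [b Ib] : add_gen I x a by apply: nzA; apply: add_gen_incl.
  have Ixb : I (x * b).
    apply: (nzC); rewrite /colon.
    have -> : x * (y * b) = y * a - y * (a - b * x) by ring.
    by apply: idealB => //; apply: ideal_mull.
  by apply: (idealBr iI) Ib; rewrite mulrC.
apply: IH; [exact: add_gen_ideal| |by rewrite add_genC].
suff -> : colon (add_gen I y) x = add_gen (colon I x) y by [].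
apply: ideal_ext => a; split=> -[b Ib]; last first.
  by exists (x * b); move: Ib; rewrite /colon mulrBr mulrA.
have [c Ic] : add_gen I x b.
  apply: nzA; exists a; rewrite -opprB [a * x]mulrC [y * b]mulrC.
  exact: idealN.
exists c; rewrite /colon.
have -> : x * (a - c * y) = x * a - b * y + y * (b - c * x) by ring.
by apply: idealD => //; apply: ideal_mull.
Qed.

(** R/(I + (x y)) is an extension of R/(I + (x)) by R/(I + (y)), since
    (I + (x y)) : x = I + (y) for a nonzerodivisor x.  The empty product gives
    the unit ideal. *)
Lemma weakly_regular_prod I (T : eqType) (l : seq T) (z : T -> R) s : is_ideal I ->
  (forall t, t \in l -> nzd_mod I (z t)) ->
  (forall t, t \in l -> weakly_regular (add_gen I (z t)) s) ->
  weakly_regular (add_gen I (\prod_(t <- l) z t)) s.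
Proof.
move=> iI; elim: l => [|t l IH] nz wz.
  rewrite big_nil; apply: weakly_regular_unit; first exact: add_gen_ideal.
  by exists 1; rewrite mulr1 subrr; apply: ideal0.
have iA := add_gen_ideal (\prod_(t <- t :: l) z t) iI.
rewrite big_cons; apply: (@weakly_regular_extension _ (z t)).
- exact: add_gen_ideal.
- suff -> : colon (add_gen I (z t * \prod_(j <- l) z j)) (z t)
          = add_gen I (\prod_(j <- l) z j).
    by apply: IH => u ul; [apply: nz | apply: wz]; rewrite inE ul orbT.
  apply: ideal_ext => a; split=> -[b Ib]; exists b.
    by apply: (nz t); rewrite ?mem_head // mulrBr [z t * (b * _)]mulrCA.
  have -> : z t * a - b * (z t * \prod_(j <- l) z j) 
          = z t * (a - b * \prod_(j <- l) z j) by ring.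
  exact: ideal_mull.
- rewrite add_genC add_gen_absorb; first by apply: wz; rewrite mem_head.
    exact: add_gen_ideal.
  by rewrite mulrC; apply: add_gen_mem.
Qed.

Lemma nzd_prod I (T : eqType) (l : seq T) (z : T -> R) :
  (forall t, t \in l -> nzd_mod I (z t)) -> nzd_mod I (\prod_(t <- l) z t).
Proof.
elim: l => [|t l IH] nz a; first by rewrite big_nil mul1r.
rewrite big_cons -mulrA => /(nz t (mem_head _ _)); apply: IH => u ul.
by apply: nz; rewrite inE ul orbT.
Qed.

Lemma prime_ideal_prod P (T : Type) (l : seq T) (Q : pred T) (z : T -> R) :
  prime_ideal P -> P (\prod_(t <- l | Q t) z t) -> exists2 t, Q t & P (z t).
Proof.
move=> [iP P1 PM]; elim/big_rec: _ => [/P1[]|t x Qt IH /PM[Pt|/IH //]].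
by exists t.
Qed.

Lemma maximal_is_prime M : maximal_ideal M -> prime_ideal M.
Proof.
move=> [iM M1 maxM]; split=> // x y Mxy.
have [Mx|Mx] := pselect (M x); [by left | right].
have [[a Ma]|] := pselect (add_gen M x 1).
  have -> : y = y * (1 - a * x) + a * (x * y) by ring.
  by apply: idealD => //; apply: ideal_mull.
move=> prA; case: Mx; apply: (maxM (add_gen M x)) => //.
- exact: add_gen_ideal.
- by move=> u Mu; apply: add_gen_incl.
- exact: add_gen_self.
Qed.

(** Krull: an ideal that is maximal among those containing I and missing a
    multiplicative set is prime. *)
Lemma prime_avoiding I (S : R -> Prop) : is_ideal I ->
  S 1 -> (forall a b, S a -> S b -> S (a * b)) -> (forall a, S a -> ~ I a) ->
  exists P, [/\ prime_ideal P, forall a, I a -> P a & forall a, S a -> ~ P a].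
Proof.
move=> iI S1 SM SI.
pose good J := [/\ is_ideal J, forall a, I a -> J a & forall a, S a -> ~ J a].
pose T := {J : R -> Prop | good J}.
pose le (J1 J2 : T) := `[< forall a, sval J1 a -> sval J2 a >].
have [|J1 J2 J3 /asboolP l12 /asboolP l23|||[P gP] maxP] :=
  @classical_sets.Zorn T le.
- by move=> J; apply/asboolP.
- by apply/asboolP=> a /l12 /l23.
- move=> [J1 g1] [J2 g2] /asboolP/= l12 /asboolP/= l21.
  by apply: eq_exist; apply: ideal_ext => a; split; [apply: l12 | apply: l21].
- move=> A totA; have [[J0 AJ0]|A0] := pselect (exists J : T, A J); last first.
    have gI : good I by split.
    by exists (exist _ I gI) => J AJ; case: A0; exists J.
  have gU : good (fun a => exists2 J : T, A J & sval J a).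
    split.
    - split; first by exists J0 => //; case: (svalP J0) => iJ _ _; apply: ideal0.
        move=> x y [J1 A1 J1x] [J2 A2 J2y].
        have [/asboolP l12|/asboolP l21] := totA _ _ A1 A2.
          exists J2 => //; case: (svalP J2) => iJ _ _; apply: idealD => //.
          exact: l12.
        exists J1 => //; case: (svalP J1) => iJ _ _; apply: idealD => //.
        exact: l21.
      move=> a x [J AJ Jx]; exists J => //.
      by case: (svalP J) => iJ _ _; apply: ideal_mull.
    - by move=> a Ia; exists J0 => //; case: (svalP J0) => _ + _; apply.
    - by move=> a Sa [J AJ]; case: (svalP J) => _ _; apply.
  by exists (exist _ _ gU) => J AJ; apply/asboolP => a Ja; exists J.
have [iP IP SP] := gP.
(* By maximality, adjoining an element outside P hits the set S. *)
have step x : ~ P x -> exists2 a, S a & add_gen P x a.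
  move=> Px; apply: contra_notP Px => noS.
  have gA : good (add_gen P x).
    split; [exact: add_gen_ideal | by move=> a /IP Pa; apply: add_gen_incl |].
    by move=> a Sa Aa; apply: noS; exists a.
  have /maxP/(congr1 sval)/= <- : le (exist good P gP) (exist _ _ gA).
    by apply/asboolP=> a /= Pa; apply: add_gen_incl.
  exact: add_gen_self.
exists P; split=> //; split=> //; first exact: SP.
move=> x y Pxy; apply: contrapT => /not_orP[/step[a Sa [b Pb]] /step[c Sc [d Pd]]].
apply: (SP (a * c)); first exact: SM.
have -> : a * c = a * (c - d * y) + (a - b * x) * (d * y) + b * d * (x * y) by ring.
do 2?[apply: idealD => //].
- exact: ideal_mull.
- exact: ideal_mulr.
- exact: ideal_mull.
Qed.

(** The multiplicative set of all t y^n with t outside P misses I, because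
    t y^n in I forces t in I, hence in P.  A prime over I that misses this set
    lies in P and does not contain y. *)
Lemma prime_below_nzd P I y : prime_ideal P -> is_ideal I ->
  (forall a, I a -> P a) -> nzd_mod I y -> P y ->
  exists P', [/\ prime_ideal P', forall a, I a -> P' a,
                 forall a, P' a -> P a & ~ P' y].
Proof.
move=> [iP P1 PM] iI IP nzy Py.
pose S a := exists t n, ~ P t /\ a = t * y ^+ n.
have [||_ [t [n [Pt ->]]]|P' [pP' IP' SP']] := @prime_avoiding I S iI.
- by exists 1, 0%N; rewrite mulr1.
- move=> _ _ [t [n [Pt ->]]] [u [k [Pu ->]]]; exists (t * u), (n + k)%N.
  split; first by case/PM.
  by rewrite exprD mulrACA.
- suff: I (t * y ^+ n) -> I t by move=> It /It /IP.
  by elim: n => [|n IH]; rewrite ?mulr1 // exprS mulrCA => /nzy.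
exists P'; split=> // [a P'a|P'y].
  apply: contrapT => Pa; apply: (SP' a) => //.
  by exists a, 0%N; rewrite mulr1.
by apply: (SP' y) => //; exists 1, 1%N; rewrite mul1r expr1.
Qed.

Lemma ideal_seq_ideal s : is_ideal (ideal_seq s).
Proof. exact: ideal_gen_ideal. Qed.

(** The chain is built from the top: dropping the last element of the
    sequence allows one step down, by [prime_below_nzd]. *)
Lemma regular_seq_chain P s : prime_ideal P ->
  (forall i, (i < size s)%N -> nzd_mod (ideal_seq (take i s)) s`_i) ->
  (forall x, x \in s -> P x) -> exists C, prime_chain_to P (size s) C.
Proof.
elim/last_ind: s P => [|s y IH] P pP nz sP.
  by exists (fun=> P); split.
have Py : P y by apply: sP; rewrite mem_rcons mem_head.
have sP' x : x \in s -> P x by move=> xs; apply: sP; rewrite mem_rcons inE xs orbT.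
have [||P' [pP' IP' P'P P'y]] := prime_below_nzd pP (ideal_seq_ideal s) _ _ Py.
- by apply: ideal_gen_sub => //; case: pP.
- have := nz (size s); rewrite size_rcons ltnSn nth_rcons ltnn eqxx.
  by rewrite -cats1 take_size_cat //; apply.
have [||C [C1 C2 C3 C4]] := IH P' pP'.
- move=> i si; have := nz i; rewrite size_rcons ltnS ltnW // nth_rcons si.
  by rewrite -cats1 takel_cat ?(ltnW si) //; apply.
- by move=> x xs; apply: IP'; apply: ideal_gen_mem.
exists (fun i => if (i <= size s)%N then C i else P); rewrite size_rcons; split.
- by move=> i _; case: ifP => // /C1.
- move=> i /=; rewrite ltnS; case: ltngtP => // [si _ x|-> _ x]; first exact: C2.
  by move=> /C4/P'P.
- move=> i /=; rewrite ltnS; case: ltngtP => // [si _|-> _]; first exact: C3.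
  by exists y => // /C4.
- by move=> x; rewrite /= ltnn.
Qed.

End Ideals.

Section Quotient.
Variables (S R : comNzRingType) (f : {rmorphism S -> R}).
Hypothesis f_surj : forall r, exists p, f p = r.
Let kerf p := f p = 0.

Lemma ker_ideal : is_ideal kerf.
Proof.
split; rewrite /kerf ?rmorph0 // => x y.
  by rewrite rmorphD => -> ->; rewrite addr0.
by rewrite rmorphM => ->; rewrite mulr0.
Qed.

Lemma preim_ideal (I : R -> Prop) : is_ideal I -> is_ideal (fun p => I (f p)).
Proof.
move=> iI; split=> [|x y|a x]; rewrite ?rmorph0 ?rmorphD ?rmorphM.
- exact: ideal0.
- exact: idealD.
- exact: ideal_mull.
Qed.

Lemma preim_prime (P : R -> Prop) : prime_ideal P -> prime_ideal (fun p => P (f p)).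
Proof.
move=> [iP P1 PM]; split; [exact: preim_ideal | by rewrite rmorph1 |].
by move=> x y; rewrite rmorphM; apply: PM.
Qed.

Lemma foldl_add_gen_ideal (I : S -> Prop) t :
  is_ideal I -> is_ideal (foldl (@add_gen S) I t).
Proof. by elim: t I => //= y t IH I iI; apply: IH; apply: add_gen_ideal. Qed.

Lemma foldl_add_gen_incl (I : S -> Prop) t p : I p -> foldl (@add_gen S) I t p.
Proof. by elim: t I => //= y t IH I Ip; apply: IH; apply: add_gen_incl. Qed.

(** Ideals of a quotient ring S/I generated by a sequence correspond to the
    ideals I + (t_1) + ... + (t_k) of S; this reduces regularity in the quotient
    to computations in S. *)
Lemma ideal_seq_map t p : ideal_seq (map f t) (f p) <-> foldl (@add_gen S) kerf t p.
Proof.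
split; last first.
  have: forall q, kerf q -> ideal_seq (map f t) (f q).
    by move=> q; rewrite /kerf => ->; exact: (ideal0 (ideal_seq_ideal _)).
  have: forall y, y \in t -> ideal_seq (map f t) (f y).
    by move=> y yt; apply: ideal_gen_mem; apply: map_f.
  have := ideal_seq_ideal (map f t); move: (ideal_seq _) => J iJ.
  elim: t kerf => [|y t IH] /= I tJ IJ; first exact: IJ.
  apply: IH => [z zt|q [a /IJ]]; first by apply: tJ; rewrite inE zt orbT.
  rewrite rmorphB rmorphM; apply: idealBr => //; apply: ideal_mull => //.
  by apply: tJ; rewrite mem_head.
pose J := foldl (@add_gen S) kerf t.
have iJ : is_ideal J by apply: foldl_add_gen_ideal; exact: ker_ideal.
have lift q q' : f q = f q' -> J q -> J q'.
  move=> fqq' Jq; apply: (idealBr iJ Jq); apply: foldl_add_gen_incl.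
  by rewrite /kerf rmorphB -fqq' subrr.
suff H : ideal_seq (map f t) (f p) -> forall q, f q = f p -> J q by move=> /H; apply.
apply: (@ideal_gen_sub _ _ (fun r => forall q, f q = r -> J q)).
  split=> [q fq|x y Jx Jy q fq|a x Jx q fq].
  - by apply: (lift 0); [rewrite rmorph0 | exact: ideal0].
  - have [u fu] := f_surj x; have [v fv] := f_surj y.
    apply: (lift (u + v)); first by rewrite rmorphD fu fv.
    by apply: idealD => //; [apply: Jx|apply: Jy].
  - have [u fu] := f_surj x; have [b fb] := f_surj a.
    apply: (lift (b * u)); first by rewrite rmorphM fu fb.
    by apply: ideal_mull => //; apply: Jx.
move=> _ /mapP[y yt ->] q fq; apply: (lift y) => //.
rewrite /J; elim: t (kerf) ker_ideal yt {iJ J lift} => //= z t IH I iI.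
rewrite inE => /orP[/eqP->|]; last by apply: IH; apply: add_gen_ideal.
by apply: foldl_add_gen_incl; apply: add_gen_self.
Qed.

Lemma weakly_regular_map s : weakly_regular kerf s ->
  forall i, (i < size s)%N -> nzd_mod (ideal_seq (take i (map f s))) (map f s)`_i.
Proof.
move=> ws i si r; have [p <-] := f_surj r.
rewrite (nth_map 0) // -map_take -rmorphM => /ideal_seq_map H.
apply/ideal_seq_map; move: H.
elim: s (kerf) i ws si => //= y s IH I [|i] [nz ws] //; first by move=> _ /nz.
exact: IH.
Qed.

End Quotient.

(** * Hilbert's basis theorem *)

Lemma ideal_seq_cat (R : comNzRingType) (s t : seq R) x :
  ideal_seq s x \/ ideal_seq t x -> ideal_seq (s ++ t) x.
Proof.
case; apply: ideal_gen_sub; try exact: ideal_seq_ideal;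
by move=> a sa; apply: ideal_gen_mem; rewrite mem_cat sa ?orbT.
Qed.

Section HilbertBasis.
Variable A : comNzRingType.
Hypothesis noethA : noetherian A.
Variable I : {poly A} -> Prop.
Hypothesis iI : is_ideal I.

Definition leading_ideal k a :=
  exists p : {poly A}, [/\ I p, (size p <= k.+1)%N & p`_k = a].

Lemma leading_ideal_ideal k : is_ideal (leading_ideal k).
Proof.
split.
- by exists 0; rewrite size_poly0 coef0; split=> //; apply: ideal0.
- move=> _ _ [p [Ip sp <-]] [q [Iq sq <-]]; exists (p + q); split.
  + exact: idealD.
  + by rewrite (leq_trans (size_polyD _ _)) // geq_max sp.
  + by rewrite coefD.
- move=> a _ [p [Ip sp <-]]; exists (a%:P * p); split.
  + exact: ideal_mull.
  + by rewrite mul_polyC (leq_trans (size_scale_leq _ _)).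
  + by rewrite coefCM.
Qed.

Lemma leading_ideal_mono k l a : (k <= l)%N -> leading_ideal k a -> leading_ideal l a.
Proof.
move=> kl [p [Ip sp <-]]; exists (p * 'X^(l - k)); split.
- exact: (ideal_mulr _ iI Ip).
- apply/leq_sizeP => j lj; rewrite coefMXn; case: ltnP => // _.
  by apply: nth_default; rewrite (leq_trans sp) // ltn_subRL subnK.
- by rewrite coefMXn ltnNge leq_subr /= subKn.
Qed.

(** The union of the increasing chain of leading ideals is generated by
    finitely many elements, which all occur at some finite stage. *)
Lemma leading_ideal_stable :
  exists N, forall k a, leading_ideal k a -> leading_ideal N a.
Proof.
have [|s sP] := @noethA (fun a => exists k, leading_ideal k a).
  split; first by exists 0%N; exact: (ideal0 (leading_ideal_ideal _)).
    move=> a b [k ka] [l lb]; exists (maxn k l); apply: idealD.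
    - exact: leading_ideal_ideal.
    - by apply: leading_ideal_mono ka; apply: leq_maxl.
    - by apply: leading_ideal_mono lb; apply: leq_maxr.
  by move=> c a [k ka]; exists k; apply: ideal_mull => //; apply: leading_ideal_ideal.
suff [N HN] : exists N, forall a, a \in s -> leading_ideal N a.
  exists N => k a ka; apply: (ideal_gen_sub (leading_ideal_ideal N) HN).
  by apply/sP; exists k.
have: forall a, a \in s -> exists k, leading_ideal k a.
  by move=> a sa; apply/sP; apply: ideal_gen_mem.
elim: s {sP} => [|b s IH] H; first by exists 0%N.
have [N HN] := IH (fun a sa => H a (@mem_behead _ (b :: s) a sa)).
have [k Hk] := H b (mem_head _ _).
exists (maxn k N) => a; rewrite inE => /orP[/eqP->|/HN].
  by apply: leading_ideal_mono Hk; apply: leq_maxl.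
by apply: leading_ideal_mono; apply: leq_maxr.
Qed.

Lemma leading_ideal_gens k : exists G : seq {poly A},
  (forall p, p \in G -> I p) /\
  (forall a, leading_ideal k a ->
     exists p, [/\ ideal_seq G p, (size p <= k.+1)%N & p`_k = a]).
Proof.
have [s sP] := noethA (leading_ideal_ideal k).
have : forall a, a \in s -> leading_ideal k a.
  by move=> a sa; apply/sP; apply: ideal_gen_mem.
move=> sL; have [G [GI Gk Gs]] : exists G : seq {poly A},
   [/\ forall p, p \in G -> I p, forall p, p \in G -> (size p <= k.+1)%N
     & s = map (coefp k) G].
  elim: s sL {sP} => [|b s IH] sL; first by exists [::].
  have [G [GI Gk ->]] := IH (fun a sa => sL a (@mem_behead _ (b :: s) a sa)).
  have [p [Ip sp pb]] := sL b (mem_head _ _).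
  exists (p :: G); split=> [q|q|/=]; rewrite ?inE; last by rewrite pb.
    by move=> /orP[/eqP->|/GI].
  by move=> /orP[/eqP->|/Gk].
exists G; split=> // a /sP.
move: a; apply: ideal_gen_sub.
  split.
  - exists 0; rewrite size_poly0 coef0; split=> //.
    exact: (ideal0 (ideal_seq_ideal _)).
  - move=> _ _ [p [Ip sp <-]] [q [Iq sq <-]]; exists (p + q); split.
    + exact: (idealD (ideal_seq_ideal _)).
    + by rewrite (leq_trans (size_polyD _ _)) // geq_max sp.
    + by rewrite coefD.
  - move=> a _ [p [Ip sp <-]]; exists (a%:P * p); split.
    + exact: (ideal_mull _ (ideal_seq_ideal _)).
    + by rewrite mul_polyC (leq_trans (size_scale_leq _ _)).
    + by rewrite coefCM.
move=> a; rewrite Gs => /mapP[p Gp ->]; exists p.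
by split=> //; [apply: ideal_gen_mem | apply: Gk].
Qed.

(** Lifts of generators of the leading ideals in degrees up to the stable one
    generate I: they allow to cancel the leading term of any element of I,
    after multiplication by a power of the variable. *)
Lemma hilbert_basis_ideal : exists s, forall p, I p <-> ideal_seq s p.
Proof.
have [N stab] := leading_ideal_stable.
have [G [GI Gk]] : exists G : seq {poly A}, (forall p, p \in G -> I p) /\
  (forall k, (k <= N)%N -> forall a, leading_ideal k a ->
     exists p, [/\ ideal_seq G p, (size p <= k.+1)%N & p`_k = a]).
  elim: N {stab} => [|N [G [GI Gk]]].
    have [G [GI Gk]] := leading_ideal_gens 0.
    by exists G; split=> // k; rewrite leqn0 => /eqP->.
  have [H [HI Hk]] := leading_ideal_gens N.+1.
  exists (H ++ G); split.
    by move=> p; rewrite mem_cat => /orP[/HI|/GI].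
  move=> k; rewrite leq_eqVlt => /orP[/eqP->|kN] a.
    by case/Hk=> p [Hp sp pk]; exists p; split=> //; apply: ideal_seq_cat; left.
  by case/(Gk _ kN)=> p [Hp sp pk]; exists p; split=> //; apply: ideal_seq_cat; right.
have iG := ideal_seq_ideal G.
exists G => p; split; last by apply: ideal_gen_sub.
have [n] := ubnP (size p); elim: n p => // n IH p sp Ip.
have [->|p0] := eqVneq p 0; first exact: ideal0.
have spE : size p = (size p).-1.+1 by rewrite prednK // size_poly_gt0.
set k := (size p).-1 in spE.
have Lk : leading_ideal (minn k N) p`_k.
  have: leading_ideal k p`_k by exists p; rewrite spE.
  by move=> L; case: (leqP k N) => // _; apply: stab L.
have [q [Gq sq qk]] := Gk _ (geq_minr _ _) _ Lk.
(* Above degree N, lift from degree N and shift. *)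
set q' := q * 'X^(k - minn k N).
have Gq' : ideal_seq G q' by exact: (ideal_mulr _ iG).
apply: (idealBr iG Gq'); apply: IH; last first.
  by apply: idealB => //; apply: ideal_mulr => //; move: Gq; apply: ideal_gen_sub.
rewrite -ltnS (leq_trans _ sp) // spE !ltnS; apply/leq_sizeP => j kj.
rewrite coefB; move: kj; rewrite leq_eqVlt => /orP[/eqP<-|kj].
  by rewrite coefMXn ltnNge leq_subr /= subKn ?geq_minl // qk subrr.
rewrite [p`__]nth_default ?spE // coefMXn ltnNge.
rewrite (leq_trans (leq_subr _ _) (ltnW kj)) /= nth_default ?subrr //.
by rewrite (leq_trans sq) // ltn_subRL subnK ?geq_minl.
Qed.
End HilbertBasis.

Theorem hilbert_basis (A : comNzRingType) : noetherian A -> noetherian {poly A}.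
Proof. by move=> nA I iI; apply: hilbert_basis_ideal. Qed.

Lemma noetherian_field (K : fieldType) : noetherian K.
Proof.
move=> I iI; have [[x [x0 Ix]]|noI] := pselect (exists x, x != 0 /\ I x).
  exists [:: 1] => y; split=> _.
    rewrite -[y]mulr1; apply: (ideal_mull _ (ideal_seq_ideal _)).
    by apply: ideal_gen_mem; rewrite mem_head.
  by rewrite -[y](divfK x0); apply: ideal_mull.
exists [::] => y; split=> [Iy|]; last by apply: ideal_gen_sub.
have [->|y0] := eqVneq y 0; first by exact: (ideal0 (ideal_seq_ideal _)).
by case: noI; exists y.
Qed.

Lemma noetherian_surj (A B : comNzRingType) (f : {rmorphism A -> B}) :
  (forall b, exists a, f a = b) -> noetherian A -> noetherian B.
Proof.
move=> fS nA I iI; have [s sP] := nA _ (preim_ideal f iI).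
exists (map f s) => b; split=> [Ib|].
  have [a fa] := fS b; rewrite -fa in Ib *.
  move/sP: Ib; move: a {b fa}; apply: ideal_gen_sub.
    by apply: preim_ideal; apply: ideal_seq_ideal.
  by move=> a sa; apply: ideal_gen_mem; apply: map_f.
move: b; apply: ideal_gen_sub => // _ /mapP[a sa ->].
by apply/sP; apply: ideal_gen_mem.
Qed.

Definition is_subring (B : comNzRingType) (S : B -> Prop) :=
  [/\ S 1, forall x y, S x -> S y -> S (x - y)
    & forall x y, S x -> S y -> S (x * y)].

(** B is generated as a ring by the image of f and l.  Quantifying over subrings
    supports induction on l, each generator being adjoined to A as a polynomial
    variable by [poly_eval]. *)
Definition generated_over (A B : comNzRingType) (f : A -> B) (l : seq B) :=
  forall S, is_subring S -> (forall a, S (f a)) -> (forall b, b \in l -> S b) ->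
  forall b, S b.

Definition poly_eval (A B : comNzRingType) (f : {rmorphism A -> B}) (b : B) :
  {rmorphism {poly A} -> B} := horner_morph (fun a => mulrC b (f a)).

Lemma poly_evalC (A B : comNzRingType) (f : {rmorphism A -> B}) b a :
  poly_eval f b a%:P = f a.
Proof. exact: horner_morphC. Qed.

Lemma poly_evalX (A B : comNzRingType) (f : {rmorphism A -> B}) b :
  poly_eval f b 'X = b.
Proof. exact: horner_morphX. Qed.

Lemma generated_over_nil (A B : comNzRingType) (f : {rmorphism A -> B}) :
  generated_over f [::] -> forall b, exists a, f a = b.
Proof.
move=> gen; apply: gen => //; last by move=> a; exists a.
split; first by exists 1; rewrite rmorph1.
  by move=> _ _ [a <-] [b <-]; exists (a - b); rewrite rmorphB.
by move=> _ _ [a <-] [b <-]; exists (a * b); rewrite rmorphM.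
Qed.

Lemma generated_over_cons (A B : comNzRingType) (f : {rmorphism A -> B}) b l :
  generated_over f (b :: l) -> generated_over (poly_eval f b) l.
Proof.
move=> gen S rS Sf Sl; apply: gen => // [a|x].
  by rewrite -(poly_evalC f b).
by rewrite inE => /orP[/eqP->|/Sl //]; rewrite -(poly_evalX f b).
Qed.

(** B is a quotient of an iterated polynomial ring over A. *)
Lemma noetherian_generated (A B : comNzRingType) (f : {rmorphism A -> B}) l :
  noetherian A -> generated_over f l -> noetherian B.
Proof.
elim: l A f => [|b l IH] A f nA gen.
  by apply: noetherian_surj nA; apply: generated_over_nil gen.
by apply: IH (generated_over_cons gen); apply: hilbert_basis.
Qed.

(** * Residue fields and Zariski's lemma *)

Section ResidueField.
Variables (R : comNzRingType) (M : R -> Prop).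
Hypothesis maxM : maximal_ideal M.

Definition max_pred (x : R) : bool := `[< M x >].

Lemma max_pred_closed : idealr_closed max_pred.
Proof.
have [iM M1 _] := maxM.
split; rewrite ?unfold_in; [by apply/asboolP; apply: ideal0 | exact/asboolP |].
move=> a x y /asboolP Mx /asboolP My; apply/asboolP.
by apply: idealD => //; apply: ideal_mull.
Qed.

HB.instance Definition _ := isIdealr.Build R max_pred max_pred_closed.

Definition residue : Type := {ideal_quot (Idealr.clone _ max_pred _)}.
HB.instance Definition _ := GRing.ComNzRing.on residue.

Definition residue_pi : R -> residue :=
  \pi_({ideal_quot (Idealr.clone _ max_pred _)})%qT.
HB.instance Definition _ := GRing.RMorphism.on residue_pi.

Lemma residue_pi0 x : residue_pi x = 0 <-> M x.
Proof.
rewrite -[0](rmorph0 residue_pi) /residue_pi; split.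
  move/eqP; rewrite -Quotient.idealrBE subr0.
  by move/asboolP.
move=> Mx; apply/eqP; rewrite -Quotient.idealrBE subr0.
exact/asboolP.
Qed.

Lemma residue_pi_surj y : exists x, residue_pi x = y.
Proof. by exists (repr y); rewrite /residue_pi reprK. Qed.

Lemma residue_inverse (y : residue) :
  exists z, (y != 0 -> z * y = 1) /\ (y = 0 -> z = 0).
Proof.
have [x <-] := residue_pi_surj y; have [iM M1 Mmax] := maxM.
have [Mx|Mx] := pselect (M x).
  by exists 0; move/residue_pi0: Mx => ->; rewrite eqxx.
have [[a Ma]|A1] := pselect (add_gen M x 1).
  exists (residue_pi a); split=> [_|/residue_pi0 //].
  rewrite -rmorphM -[RHS](rmorph1 residue_pi).
  apply/eqP; rewrite eq_sym -subr_eq0 -rmorphB; apply/eqP.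
  exact/residue_pi0.
case: Mx; apply: (Mmax (add_gen M x)) => //; first exact: add_gen_ideal.
  by move=> u Mu; apply: add_gen_incl.
exact: add_gen_self.
Qed.

Definition residue_inv (y : residue) : residue := projT1 (cid (residue_inverse y)).

Fact residue_mulVf (y : residue) : y != 0 -> residue_inv y * y = 1.
Proof. by rewrite /residue_inv; case: cid => z /= []. Qed.
Fact residue_inv0 : residue_inv 0 = 0.
Proof. by rewrite /residue_inv; case: cid => z /= [_]; apply. Qed.

HB.instance Definition _ := GRing.ComNzRing_isField.Build residue
  residue_mulVf residue_inv0.

(** A packaging of R/M that forgets its construction. *)
Lemma residue_field : exists (L : fieldType) (f : {rmorphism R -> L}),
  (forall y, exists x, f x = y) /\ (forall x, f x = 0 <-> M x).
Proof.
exists residue, residue_pi; split; [exact: residue_pi_surj | exact: residue_pi0].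
Qed.
End ResidueField.

(** 1 + X c is coprime to c, so that it can divide a power of c only if it is
    constant. *)
Lemma one_addX_dvd_exp (L : fieldType) (c q : {poly L}) n :
  c ^+ n = (1 + 'X * c) * q -> c = 0.
Proof.
move=> e; have dv : 1 + 'X * c %| c ^+ n * 1 by rewrite mulr1 e dvdp_mulr.
have cop : coprimep (1 + 'X * c) c.
  by rewrite coprimep_sym addrC coprimep_addl_mul coprimep1.
move: dv; rewrite Gauss_dvdpr ?coprimep_expr // dvdp1.
apply: contraTeq => c0.
rewrite addrC mulrC size_polyDl size_mulX // ?size_poly1 ?ltnS ?size_poly_gt0 //.
by rewrite eqSS size_poly_eq0.
Qed.

Section Goldman.
Variable L : fieldType.

(** The domain f(A) is a Goldman domain: inverting the single element f(c)
    turns it into its field of fractions. *)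
Definition goldman (A : comNzRingType) (f : {rmorphism A -> L}) :=
  exists2 c, f c != 0 &
    forall p, f p != 0 -> exists n q, f c ^+ n = f p * f q.

Variables (A : comNzRingType) (f : {rmorphism A -> L}).

Lemma integral_exp y n : integralOver f y -> integralOver f (y ^+ n).
Proof.
move=> iy; elim: n => [|n IH]; first exact: integral1.
by rewrite exprS; apply: integral_mul.
Qed.

Lemma integral_map_horner (p : {poly A}) y :
  integralOver f y -> integralOver f (map_poly f p).[y].
Proof.
move=> iy; apply: integral_horner => //; apply/integral_poly => i.
by rewrite coef_map; apply: integral_id.
Qed.

(** Multiply an equation of degree k + 1 for b, with leading coefficient a, by
    a^k: it becomes a monic equation for a b. *)
Lemma algebraic_scaled_integral (b : L) (P : {poly A}) :
  map_poly f P != 0 -> (map_poly f P).[b] = 0 ->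
  exists2 a, f a != 0 & integralOver f (f a * b).
Proof.
move=> Q0 Qb; set Q := map_poly f P in Q0 Qb.
have sQ : (1 < size Q)%N.
  rewrite ltnNge; apply: contra_neqN Q0 => /size1_polyC QC.
  by move: Qb; rewrite QC hornerC => ->.
set k := (size Q).-2.
have sQE : size Q = k.+2 by rewrite /k; case: (size Q) sQ => [|[]].
pose a := P`_k.+1; have fa : f a = lead_coef Q by rewrite lead_coefE sQE coef_map.
exists a; first by rewrite fa lead_coef_eq0.
exists ('X^(k.+1) + \poly_(i < k.+1) (P`_i * a ^+ (k - i))).
  rewrite monicE lead_coefDl ?lead_coefXn //.
  by rewrite size_polyXn ltnS size_poly.
rewrite rootE rmorphD /= map_polyXn hornerD hornerXn.
have -> : map_poly f (\poly_(i < k.+1) (P`_i * a ^+ (k - i)))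
        = \poly_(i < k.+1) (f (P`_i) * f a ^+ (k - i)).
  apply/polyP=> i; rewrite coef_map !coef_poly; case: ifP => _; last exact: rmorph0.
  by rewrite /= rmorphM rmorphXn.
rewrite horner_poly.
suff -> : (f a * b) ^+ k.+1 + \sum_(i < k.+1) f P`_i * f a ^+ (k - i) * (f a * b) ^+ i
   = f a ^+ k * Q.[b] by rewrite Qb mulr0.
rewrite horner_coef sQE [in RHS]big_ord_recr /= mulrDr mulr_sumr addrC; congr (_ + _).
  apply: eq_bigr => i _; rewrite coef_map /= exprMn.
  have -> : f a ^+ k = f a ^+ (k - i) * f a ^+ i.
    by rewrite -exprD subnK // -ltnS.
  by ring.
by rewrite coef_map /= -/a exprMn [in LHS]exprSr; ring.
Qed.

Lemma integral_clear_denom (a : A) (b : L) (q : {poly A}) :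
  integralOver f (f a * b) -> integralOver f (f a ^+ size q * (map_poly f q).[b]).
Proof.
move=> iab; rewrite (@horner_coef_wide _ (size q)) ?size_poly // mulr_sumr.
elim/big_ind: _ => [||i _]; [exact: integral0 | exact: integral_add |].
rewrite coef_map /=.
have -> : f a ^+ size q * (f q`_i * b ^+ i)
        = f q`_i * f a ^+ (size q - i) * (f a * b) ^+ i.
  have -> : f a ^+ size q = f a ^+ (size q - i) * f a ^+ i.
    by rewrite -exprD subnK // ltnW.
  by rewrite exprMn; ring.
apply: integral_mul; last exact: integral_exp.
by apply: integral_mul; [|apply: integral_exp]; apply: integral_id.
Qed.

(** Divide an equation for y by a power of the variable until its constant term
    is nonzero; that term is then a multiple of y. *)
Lemma algebraic_divides_base (y : L) (p : {poly A}) :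
  y != 0 -> map_poly f p != 0 -> (map_poly f p).[y] = 0 ->
  exists c p', f c != 0 /\ f c = y * (map_poly f p').[y].
Proof.
move=> y0; elim/poly_ind: p => [|p c IH]; first by rewrite rmorph0 eqxx.
rewrite rmorphD rmorphM /= map_polyX map_polyC /= hornerMXaddC.
have [-> Q0 /eqP|fc _ e] := eqVneq (f c) 0.
  rewrite !addr0 mulf_eq0 (negPf y0) orbF => /eqP; apply: IH.
  by apply: contraNneq Q0 => ->; rewrite mul0r addr0.
exists c, (- p); split=> //; rewrite rmorphN hornerN mulrN mulrC.
by apply/eqP; rewrite -addr_eq0 addrC e.
Qed.

(** If e = d / p satisfies a monic equation of degree r, clearing the
    denominators p shows that p divides d^r. *)
Lemma integral_quotient (d p : A) (e : L) :
  integralOver f e -> f d = f p * e -> exists n q, f d ^+ n = f p * f q.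
Proof.
move=> [m mon_m rm] de.
have [m0|[k sm]] : size m = 0%N \/ exists k, size m = k.+1.
- by case: (size m) => [|k]; [left | right; exists k].
- move/eqP: m0; rewrite size_poly_eq0 => /eqP m0.
  by rewrite m0 monicE lead_coef0 eq_sym oner_eq0 in mon_m.
case: k sm => [|k] sm.
  have m1 : m = 1.
    have /size1_polyC mC : (size m <= 1)%N by rewrite sm.
    move: mon_m; rewrite mC monicE lead_coefC => /eqP->; by rewrite polyC1.
  by move: rm; rewrite m1 rmorph1 rootE hornerC oner_eq0.
exists k.+1, (- \sum_(i < k.+1) m`_i * p ^+ (k - i) * d ^+ i).
have mk : m`_k.+1 = 1 by have /monicP := mon_m; rewrite lead_coefE sm.
have := rm; rewrite rootE (@horner_coef_wide _ k.+2) ?(leq_trans (size_poly _ _)) ?sm //.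
rewrite big_ord_recr /= coef_map /= mk rmorph1 mul1r addrC addr_eq0 => /eqP ek.
rewrite de exprMn ek rmorphN rmorph_sum !mulrN !mulr_sumr; congr (- _).
apply: eq_bigr => i _; rewrite coef_map /= !rmorphM !rmorphXn /= de exprMn.
have -> : f p ^+ k.+1 = f p * f p ^+ (k - i) * f p ^+ i.
  by rewrite -exprS -exprD addSn subnK // -ltnS.
by ring.
Qed.

(** If f(A)[b] is a Goldman domain, so is f(A).  First, b is algebraic over
    f(A): otherwise 1 + b c would be a nonzero element that divides no power of
    c.  Then a b and d / c are integral over f(A) for suitable nonzero a and d in
    f(A).  Hence every 1 / p, which lies in f(A)[b, 1 / c], is integral over
    f(A)[1 / (a d)], and therefore belongs to it. *)
Lemma goldman_descent b : goldman (poly_eval f b) -> goldman f.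
Proof.
move=> [c c0 cP]; set C := poly_eval f b c in c0 cP.
have [P P0 Pb] : exists2 P, map_poly f P != 0 & poly_eval f b P = 0.
  have [e|/cP[n [q e]]] := eqVneq (poly_eval f b (1 + 'X * c)) 0.
    exists (1 + 'X * c) => //; apply/eqP => /(congr1 (fun p : {poly L} => p`_0)).
    rewrite coef_map coefD coefXM /= coef1 addr0 rmorph1 coef0.
    by move/eqP; rewrite oner_eq0.
  exists (c ^+ n - (1 + 'X * c) * q); last first.
    by rewrite rmorphB rmorphM rmorphXn -/C e subrr.
  rewrite rmorphB subr_eq0; apply: contraNneq c0.
  rewrite rmorphXn rmorphM rmorphD rmorph1 rmorphM /= map_polyX => /one_addX_dvd_exp e0.
  by rewrite /C /= /horner_morph e0 horner0.
have [a a0 iab] := algebraic_scaled_integral P0 Pb.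
(* C with its denominators cleared, hence integral. *)
pose y := f a ^+ size c * C.
have iy : integralOver f y by apply: integral_clear_denom.
have y0 : y != 0 by rewrite mulf_neq0 ?expf_neq0.
have [m mon_m rm] := iy.
have fm0 : map_poly f m != 0 by apply/monic_neq0/monic_map.
have [d [p' [d0 dE]]] := algebraic_divides_base y0 fm0 (rootP rm).
set y' := (map_poly f p').[y] in dE.
have iy' : integralOver f y' by apply: integral_map_horner.
exists (a * d); first by rewrite rmorphM mulf_neq0.
move=> p p0; have [|n [q e]] := cP p%:P; first by rewrite poly_evalC.
rewrite poly_evalC in e.
(* e' is the quotient of a multiple of f d ^+ n by f p. *)
pose e' := f a ^+ (size c * n) * y' ^+ n * (f a ^+ size q * poly_eval f b q).
have ie' : integralOver f e'.
  apply: integral_mul; last exact: integral_clear_denom.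
  apply: integral_mul; last exact: integral_exp.
  exact/integral_exp/integral_id.
have [|r [q' E]] := @integral_quotient (a ^+ size q * d ^+ n) p e' ie'.
  rewrite rmorphM !rmorphXn /= dE /e' /y !exprMn e exprM; ring.
exists ((size q + n) * r)%N, (q' * (a ^+ n * d ^+ size q) ^+ r).
rewrite [in RHS]rmorphM mulrA -E -!rmorphXn -rmorphM; congr (f _).
by rewrite exprM -exprMn; congr (_ ^+ _); rewrite exprD !exprMn; ring.
Qed.
End Goldman.

Lemma goldman_generated (L : fieldType) (A : comNzRingType)
  (f : {rmorphism A -> L}) l : generated_over f l -> goldman f.
Proof.
elim: l A f => [|b l IH] A f gen.
  have fS := generated_over_nil gen.
  exists 1; first by rewrite rmorph1 oner_eq0.
  move=> p p0; have [q fq] := fS (f p)^-1.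
  by exists 1%N, q; rewrite fq mulfV // rmorph1.
by apply: goldman_descent; apply: IH (generated_over_cons gen).
Qed.

(** A field L that is finitely generated over K is algebraic over K.  As a
    field, L is trivially a Goldman domain; descending along the generators
    shows that K[b] is one.  If b were transcendental, then 1 + b c would have
    to divide a power of c in K[b]. *)
Theorem zariski_lemma (K L : fieldType) (f : {rmorphism K -> L}) l b :
  generated_over f l -> exists2 P : {poly K}, P != 0 & poly_eval f b P = 0.
Proof.
move=> gen; have genb : generated_over f (b :: l).
  by move=> S rS Sf Sl; apply: gen => // x xl; apply: Sl; rewrite inE xl orbT.
have [c c0 cP] := goldman_generated (generated_over_cons genb).
have [e|/cP[n [q e]]] := eqVneq (poly_eval f b (1 + 'X * c)) 0.
  exists (1 + 'X * c) => //; apply/eqP => /(congr1 (fun p : {poly K} => p`_0)).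
  by rewrite coefD coefXM /= coef1 addr0 coef0 => /eqP; rewrite oner_eq0.
exists (c ^+ n - (1 + 'X * c) * q); last by rewrite rmorphB rmorphM rmorphXn e subrr.
rewrite subr_eq0; apply: contraNneq c0 => /one_addX_dvd_exp->.
by rewrite rmorph0.
Qed.

(** * Chains of primes in polynomial rings *)

(** A matrix with more rows than columns has a nonzero left kernel. *)
Lemma linear_dependence (K : fieldType) (I J : finType) (a : I -> J -> K) :
  (#|J| < #|I|)%N ->
  exists c : I -> K, (exists i, c i != 0) /\ forall j, \sum_i c i * a i j = 0.
Proof.
move=> JI; pose A := \matrix_(i < #|I|, j < #|J|) a (enum_val i) (enum_val j).
have : kermx A != 0.
  rewrite kermx_eq0 /row_free neq_ltn (leq_ltn_trans _ JI) //.
  exact: rank_leq_col.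
case/matrix0Pn=> r [s rs0].
exists (fun i => kermx A r (enum_rank i)); split.
  by exists (enum_val s); rewrite enum_valK.
move=> j; have /matrixP/(_ r (enum_rank j)) := mulmx_ker A.
rewrite mxE [RHS]mxE => kerE; rewrite -[RHS]kerE (reindex (@enum_val _ I)) /=.
  by apply: eq_bigr => i _; rewrite !mxE enum_valK enum_rankK.
by exists enum_rank => i _; [exact: enum_valK | exact: enum_rankK].
Qed.

Section Dimension.
Variables (K : fieldType) (n : nat).
Local Notation S := {mpoly K[n]}.
Implicit Types (P Q : S -> Prop) (p q u : S).

Definition independent_mod P (I : finType) (w : I -> S) :=
  forall c : I -> K, P (\sum_i c i *: w i) -> forall i, c i = 0.

(** In a relation with coefficients in the span of w, the part without u lies in
    Q, since u does; hence it vanishes, and u can be divided out because P is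
    prime and does not contain u. *)
Lemma independent_mod_powers P Q u (I : finType) (w : I -> S) t :
  prime_ideal P -> is_ideal Q -> (forall p, P p -> Q p) -> Q u -> ~ P u ->
  independent_mod Q w ->
  independent_mod P (fun ji : 'I_t * I => u ^+ ji.1 * w ji.2).
Proof.
move=> [iP P1 PM] iQ PQ Qu Pu indw.
have main : forall c : nat -> I -> K,
    P (\sum_(j < t) u ^+ j * \sum_i c j i *: w i) ->
    forall j, (j < t)%N -> forall i, c j i = 0.
  elim: t => [//|t IH] c Pc.
  have E : \sum_(j < t.+1) u ^+ j * (\sum_i c j i *: w i)
    = \sum_i c 0%N i *: w i + u * \sum_(j < t) u ^+ j * \sum_i c j.+1 i *: w i.
    rewrite big_ord_recl expr0 mul1r; congr (_ + _); rewrite mulr_sumr.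
    by apply: eq_bigr => j _; rewrite lift0 exprS mulrA.
  rewrite E in Pc.
  have c0 : forall i, c 0%N i = 0.
    apply: indw; move/PQ: Pc; rewrite -[X in _ + X]opprK; apply: idealBr => //.
    by apply: idealN => //; apply: ideal_mulr.
  move: Pc; rewrite big1 => [|i _]; last by rewrite c0 scale0r.
  rewrite add0r => /PM[//|/(IH (fun j => c j.+1)) IHc].
  by case=> [_|j jt]; [exact: c0 | apply: IHc].
move=> c Pc [j i]; pose c' k i := if insub k is Some j then c (j : 'I_t, i) else 0.
suff H : P (\sum_(j < t) u ^+ j * \sum_i c' j i *: w i).
  by have := main c' H j (ltn_ord j) i; rewrite /c' valK.
congr (P _): Pc; apply/esym.
transitivity (\sum_(j < t) \sum_i c (j, i) *: (u ^+ j * w i)); last first.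
  by rewrite pair_bigA; apply: eq_bigr => -[].
apply: eq_bigr => k _; rewrite mulr_sumr; apply: eq_bigr => l _.
by rewrite /c' valK scalerAr.
Qed.

Lemma msizeM_le_deg p q a b :
  (msize p <= a.+1)%N -> (msize q <= b.+1)%N -> (msize (p * q) <= (a + b).+1)%N.
Proof.
move=> pa qb; have [->|p0] := eqVneq p 0; first by rewrite mul0r msize0.
have [->|q0] := eqVneq q 0; first by rewrite mulr0 msize0.
by rewrite msizeM // -subn1 leq_subLR (leq_trans (leq_add pa qb)) // addSn addnS.
Qed.

Lemma msizeX_le_deg p a j : (msize p <= a.+1)%N -> (msize (p ^+ j) <= (j * a).+1)%N.
Proof.
move=> pa; elim: j => [|j IH]; first by rewrite expr0 msize1.
by rewrite exprS mulSn; apply: msizeM_le_deg.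
Qed.

(** Choosing u_i in C_i but not in C_(i-1), the products of powers u_i^(a_i)
    with all a_i < t are independent modulo C_0; their degrees grow linearly in
    t, and D does not depend on t. *)
Lemma independent_mod_chain k (C : nat -> S -> Prop) :
  (forall i, (i <= k)%N -> prime_ideal (C i)) ->
  (forall i, (i < k)%N -> forall p, C i p -> C i.+1 p) ->
  (forall i, (i < k)%N -> exists2 p, C i.+1 p & ~ C i p) ->
  exists D, forall t, exists (I : finType) (w : I -> S),
    [/\ #|I| = (t ^ k)%N, forall i, (msize (w i) <= (t * D).+1)%N
      & independent_mod (C 0%N) w].
Proof.
elim: k C => [|k IH] C pC incC ltC.
  exists 0%N => t; exists unit, (fun=> 1); split; first by rewrite card_unit.
    by move=> _; rewrite msize1.
  have [iC C1 _] := pC 0%N isT.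
  move=> c; rewrite (big_pred1 tt); last by case.
  move=> Cc [] //; apply/eqP; apply/negPn/negP => c0; apply: C1.
  have := ideal_mull ((c tt)^-1)%:MP iC Cc.
  by rewrite mul_mpolyC scalerA mulVf // scale1r.
have [D HD] := IH (fun i => C i.+1) (fun i => pC i.+1) (fun i => incC i.+1)
  (fun i => ltC i.+1).
have [u C1u C0u] := ltC 0%N isT.
exists (msize u + D)%N => t; have [I [w [cI wD indw]]] := HD t.
exists ('I_t * I)%type, (fun ji : 'I_t * I => u ^+ ji.1 * w ji.2); split.
- by rewrite card_prod card_ord cI expnS.
- move=> [j i] /=; rewrite mulnDr; apply: msizeM_le_deg => //.
  have := @msizeX_le_deg u (msize u) j (leqnSn _).
  by move/leq_trans; apply; rewrite ltnS leq_mul2r ltnW ?orbT.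
- have [iC1 _ _] := pC 1%N isT.
  exact: independent_mod_powers (pC 0%N isT) iC1 (incC 0%N isT) C1u C0u indw.
Qed.

(** All other monomials of p are divisible by a variable in P. *)
Lemma mem_ideal_of_box P (B : {set 'I_n}) b p : is_ideal P ->
  (forall v, v \notin B -> P 'X_v) -> (msize p <= b.+1)%N ->
  (forall m : 'X_{1..n}, (forall v, v \notin B -> m v = 0%N) ->
     (forall v, (m v <= b)%N) -> p@_m = 0) ->
  P p.
Proof.
move=> iP PB pb box; rewrite [p]mpolyE big_seq; apply: ideal_sum => // m mp.
rewrite -mul_mpolyC; apply: ideal_mull => //.
have [[v vB mv]|mB] := pselect (exists2 v, v \notin B & m v <> 0%N).
  rewrite mpolyXE_id (bigD1 v) //=; apply: ideal_mulr => //.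
  by case: (m v) mv => // k _; rewrite exprS; apply: ideal_mulr => //; apply: PB.
move: (mp); rewrite mcoeff_msupp box ?eqxx // => v.
  by move=> vB; apply: contrapT => mv; apply: mB; exists v.
have := msize_mdeg_lt mp; move/leq_trans/(_ pb); rewrite ltnS; apply: leq_trans.
by rewrite mdegE (bigD1 v) //= leq_addr.
Qed.

(** If k > #|B|, the t^k independent elements of degree at most t D outnumber,
    for t large, the (t D + 1)^#|B| monomials in the variables of B with
    exponents at most t D.  So some nontrivial linear combination contains none of
    these monomials, and then it lies in C_0 by [mem_ideal_of_box]. *)
Theorem prime_chain_bound k (C : nat -> S -> Prop) (B : {set 'I_n}) :
  (forall i, (i <= k)%N -> prime_ideal (C i)) ->
  (forall i, (i < k)%N -> forall p, C i p -> C i.+1 p) ->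
  (forall i, (i < k)%N -> exists2 p, C i.+1 p & ~ C i p) ->
  (forall v, v \notin B -> C 0%N 'X_v) -> (k <= #|B|)%N.
Proof.
move=> pC incC ltC CB; rewrite leqNgt; apply/negP => Bk.
have [D HD] := independent_mod_chain pC incC ltC.
(* This t satisfies (t D + 1)^b <= t^b (D + 1)^b < t^(b + 1) with b = #|B|. *)
pose t := (D.+1 ^ #|B|).+1; have [I [w [cI wD indw]]] := HD t.
pose J := {ffun {v | v \in B} -> 'I_(t * D).+1}.
have JI : (#|J| < #|I|)%N.
  rewrite cI card_ffun card_ord card_sig.
  have -> : #|[pred x | x \in B]| = #|B| by apply: eq_card.
  apply: (@leq_ltn_trans ((t * D.+1) ^ #|B|)).
    have tD : ((t * D).+1 <= t * D.+1)%N by rewrite mulnS -addn1 addnC leq_add2r.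
    by elim: #|B| => // b IH; rewrite !expnS leq_mul.
  rewrite expnMn (@leq_trans (t ^ #|B|.+1)) //; last by rewrite leq_pexp2l.
  by rewrite expnSr ltn_pmul2l // expn_gt0.
pose mon (f : J) :=
  [multinom (if insub v is Some x then nat_of_ord (f x) else 0%N) | v < n].
have [c [[i ci] cJ]] :=
  @linear_dependence K _ _ (fun i (f : J) => (w i)@_(mon f)) JI.
case/eqP: ci; apply: indw; apply: (@mem_ideal_of_box _ B (t * D)) => //.
- by case: (pC 0%N isT).
- apply: (leq_trans (msize_sum _ _ _)); apply/bigmax_leqP => j _.
  by apply: (leq_trans (msizeZ_le _ _)).
move=> m mB mb; pose f : J := [ffun x : {v | v \in B} => inord (m (val x))].
have -> : m = mon f.
  apply/mnmP => v; rewrite mnmE; case: insubP => [x _ <-|/mB //].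
  by rewrite ffunE inordK // ltnS.
rewrite -[RHS](cJ f) raddf_sum; apply: eq_bigr => j _.
exact: mcoeffZ.
Qed.
End Dimension.

(** * Univariate polynomials as nonzerodivisors *)

Lemma mpoly_generated (R : comNzRingType) n :
  generated_over (@mpolyC n R) [seq 'X_i | i <- enum 'I_n].
Proof.
move=> P [P1 PB PM] PC PX p.
have P0 : P 0 by rewrite -[0](subrr 1); apply: PB.
have PD a b : P a -> P b -> P (a + b).
  by move=> Pa Pb; rewrite -[b]opprK; apply: (PB) => //; rewrite -sub0r; apply: PB.
rewrite [p]mpolyE; elim/big_ind: _ => [||m _]; [exact: P0 | exact: PD |].
rewrite -mul_mpolyC; apply: (PM) => //; rewrite mpolyXE_id.
elim/big_ind: _ => [||i _]; [exact: P1 | exact: PM |].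
elim: (m i) => [|k IH]; first by rewrite expr0.
by rewrite exprS; apply: (PM) => //; apply/PX/map_f; rewrite mem_enum.
Qed.

Section PolyIdeal.
Variables (R : comNzRingType) (J : R -> Prop).
Hypothesis iJ : is_ideal J.

(** A monic polynomial is a nonzerodivisor on (R/J)[X]: the leading coefficient
    of G Q is that of Q. *)
Lemma coef_ideal_monic (G Q : {poly R}) : G \is monic ->
  (forall i, J (G * Q)`_i) -> forall i, J Q`_i.
Proof.
move=> mG; have [k] := ubnP (size Q); elim: k Q => // k IH Q sQ JGQ i.
have [->|Q0] := eqVneq Q 0; first by rewrite coef0; apply: ideal0.
have sQE : size Q = (size Q).-1.+1 by rewrite prednK // size_poly_gt0.
have Jl : J (lead_coef Q).
  by rewrite -[lead_coef Q](lead_coef_monicM _ mG) lead_coefE; apply: JGQ.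
pose h := lead_coef Q *: 'X^((size Q).-1).
have Jh j : J h`_j.
  by rewrite coefZ; apply: ideal_mulr.
have : J (Q - h)`_i; last by rewrite coefB; apply: idealBr.
apply: IH => [|j]; last first.
  rewrite mulrBr coefB; apply: idealB => //.
  by rewrite coefM; apply: ideal_sum => // l _; apply: ideal_mull.
rewrite -ltnS (leq_trans _ sQ) // ltnS sQE ltnS; apply/leq_sizeP => j.
rewrite leq_eqVlt => /orP[/eqP<-|ij].
  by rewrite coefB coefZ coefXn eqxx mulr1 lead_coefE subrr.
rewrite coefB coefZ coefXn gtn_eqF // mulr0 subr0 nth_default //.
by rewrite sQE.
Qed.

Lemma horner_ideal (Q : {poly R}) x : (forall i, J Q`_i) -> J Q.[x].
Proof.
by move=> JQ; rewrite horner_coef; apply: ideal_sum => // i _; apply: ideal_mulr.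
Qed.
End PolyIdeal.

Section Generators.
Variables (R : comNzRingType) (T : finType) (q : T -> R).

Definition generated_by (W : {set T}) (p : R) : Prop :=
  exists c : T -> R, p = \sum_(w in W) c w * q w.

Lemma generated_by_ideal W : is_ideal (generated_by W).
Proof.
split.
- by exists (fun=> 0); rewrite big1 // => w _; rewrite mul0r.
- move=> _ _ [c ->] [d ->]; exists (fun w => c w + d w).
  by rewrite -big_split; apply: eq_bigr => w _; rewrite mulrDl.
- move=> a _ [c ->]; exists (fun w => a * c w).
  by rewrite mulr_sumr; apply: eq_bigr => w _; rewrite mulrA.
Qed.

Lemma generated_by_mem (W : {set T}) w : w \in W -> generated_by W (q w).
Proof.
move=> wW; exists (fun v => (v == w)%:R); rewrite (bigD1 w) //= eqxx mul1r.
by rewrite big1 ?addr0 // => v /andP[_ /negPf->]; rewrite mul0r.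
Qed.

Lemma generated_by_setU1 (W : {set T}) v : v \notin W ->
  add_gen (generated_by W) (q v) = generated_by (v |: W).
Proof.
move=> vW; apply: ideal_ext => p; split.
  case=> a [c E]; exists (fun w => if w == v then a else c w).
  rewrite big_setU1 //= eqxx -[p](subrK (a * q v)) E addrC; congr (_ + _).
  by apply: eq_bigr => w wW; case: eqP wW vW => // -> ->.
case=> c ->; exists (c v), c.
by rewrite big_setU1 //= addrAC subrr add0r.
Qed.
End Generators.

Section Separated.
Variables (K : fieldType) (n : nat).
Local Notation S := {mpoly K[n]}.

(** The expansion of a polynomial in powers of the variable x_v.  The constants
    used for it are again polynomials in all variables, which spares a change
    of the ground ring. *)
Definition isolate (v : 'I_n) : {rmorphism S -> {poly S}} :=
  mmap (polyC \o @mpolyC n K) (fun i => if i == v then 'X else ('X_i : S)%:P).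

Lemma isolateC v c : isolate v c%:MP = (c%:MP)%:P.
Proof. by rewrite /= mmapC. Qed.

Lemma isolateX v i : isolate v 'X_i = if i == v then 'X else ('X_i)%:P.
Proof. by rewrite /= mmapX mmap1U. Qed.

Local Opaque isolate.

Lemma isolateK v p : (isolate v p).['X_v] = p.
Proof.
move: (isolate v) (isolateC v) (isolateX v) => phi phiC phiX.
apply: (@mpoly_generated K n (fun p => (phi p).['X_v] = p)).
- split=> [|a b Ea Eb|a b Ea Eb].
  + by rewrite rmorph1 -polyC1 hornerC.
  + by rewrite rmorphB hornerD hornerN Ea Eb.
  + by rewrite rmorphM hornerM Ea Eb.
- by move=> c; rewrite phiC hornerC.
- move=> _ /mapP[i _ ->]; rewrite phiX; case: eqP => [->|_].
    by rewrite hornerX.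
  by rewrite hornerC.
Qed.

Definition univariate (g : {poly K}) (v : 'I_n) : S :=
  (map_poly (@mpolyC n K) g).['X_v].

Lemma isolate_univariate v w g :
  isolate v (univariate g w) = if w == v then map_poly (@mpolyC n K) g
                               else (univariate g w)%:P.
Proof.
rewrite /univariate -horner_map isolateX -map_poly_comp.
have -> : map_poly (isolate v \o @mpolyC n K) g = (map_poly (@mpolyC n K) g)^:P.
  by rewrite -map_poly_comp; apply: eq_map_poly => c; rewrite /= isolateC.
case: eqP => _; first exact: comp_polyXr.
by rewrite horner_map.
Qed.

(** In powers of x_v, the element g(x_v) is a monic polynomial with constant
    coefficients, and an ideal whose generators do not involve x_v is stable
    under taking coefficients; so [coef_ideal_monic] applies. *)
Lemma univariate_nzd (g : {poly K}) (q : 'I_n -> S) (W : {set 'I_n}) v :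
  g \is monic -> (forall w, w \in W -> isolate v (q w) = (q w)%:P) ->
  nzd_mod (generated_by q W) (univariate g v).
Proof.
move=> mg qW a Ja; have iJ := generated_by_ideal q W.
rewrite -(isolateK v a); apply: horner_ideal => //.
apply: (coef_ideal_monic iJ (monic_map (@mpolyC n K) mg)) => i.
have -> : map_poly (@mpolyC n K) g = isolate v (univariate g v).
  by rewrite isolate_univariate eqxx.
rewrite -rmorphM; case: Ja => c ->; rewrite rmorph_sum coef_sum.
exists (fun w => (isolate v (c w))`_i); apply: eq_bigr => w wW.
by rewrite rmorphM qW // coefMC.
Qed.
End Separated.

(** * Elementary symmetric functions on a matroid complex *)

Section ElementarySymmetric.
Variables (K : fieldType) (n : nat) (g : 'I_n -> {poly K}).
Hypothesis g_monic : forall v, g v \is monic.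
Hypothesis g_root0 : forall v, root (g v) 0.
Local Notation S := {mpoly K[n]}.

Let z v : S := univariate (g v) v.

Definition elem_sym k : S := \sum_(A : {set 'I_n} | #|A| == k) \prod_(v in A) z v.

(** The order e_k, ..., e_1 matters: e_k comes first because it is a product,
    modulo whose factors the tail is a sequence of the same kind. *)
Fixpoint elem_sym_seq k : seq S :=
  if k is k'.+1 then elem_sym k :: elem_sym_seq k' else [::].

Section Face.
Variable F : {set 'I_n}.
Let q v : S := if v \in F then z v else 'X_v.

(** This is where the root 0 of the polynomials g is used: outside F, z v is a
    multiple of the variable x_v, which vanishes on the face F. *)
Lemma dvd_z v : exists a, z v = a * q v.
Proof.
rewrite /q; case: ifP => _; first by exists 1; rewrite mul1r.
have /factor_theorem[h gh] := g_root0 v.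
exists (univariate h v); rewrite /z /univariate gh subr0 rmorphM /= map_polyX.
by rewrite hornerM hornerX.
Qed.

Lemma isolate_q v w : w != v -> isolate K v (q w) = (q w)%:P.
Proof.
move=> /negPf wv; rewrite /q; case: ifP => _.
  by rewrite /z isolate_univariate wv.
by rewrite isolateX wv.
Qed.

(** Modulo the q w with w in W, a product of k of the z v vanishes unless it
    runs over the whole complement of W.  So e_k becomes the product of the
    z v = q v, v outside W, and dividing by one such factor enlarges W. *)
Lemma weakly_regular_face k (W : {set 'I_n}) :
  ~: W \subset F -> #|~: W| = k -> weakly_regular (generated_by q W) (elem_sym_seq k).
Proof.
elim: k W => //= k IH W WF cW; set J := generated_by q W.
have iJ : is_ideal J by apply: generated_by_ideal.
have Jz v : v \in W -> J (z v).
  move=> vW; have [a ->] := dvd_z v.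
  by apply: ideal_mull => //; apply: generated_by_mem.
have nz v : v \in enum (~: W) -> nzd_mod J (z v).
  rewrite mem_enum inE => vW; apply: univariate_nzd => // w wW.
  by apply: isolate_q; apply: contraNneq vW => <-.
(* A set of size k + 1 other than the complement of W meets W. *)
have Jdiff : J (elem_sym k.+1 - \prod_(v <- enum (~: W)) z v).
  rewrite big_enum /elem_sym (bigD1 (~: W)) ?cW //=.
  rewrite addrAC subrr add0r.
  apply: ideal_sum => // A /andP[/eqP cA AW].
  have /subsetPn[v vA vW] : ~~ (A \subset ~: W).
    by apply: contraNN AW => AW; rewrite eqEcard AW cW cA leqnn.
  rewrite (bigD1 v) //=; apply: ideal_mulr => //; apply: Jz.
  by rewrite inE negbK in vW.
split.
  move=> a Ja; apply: (nzd_prod nz).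
  apply: (idealBr iJ Ja).
  by rewrite -mulrBl; apply: ideal_mulr => //; rewrite -opprB; apply: idealN.
rewrite (add_gen_congr iJ Jdiff); apply: weakly_regular_prod => // v vW.
have vW' := vW; rewrite mem_enum inE in vW.
have -> : z v = q v by rewrite /q (subsetP WF) // inE.
rewrite generated_by_setU1 //; apply: IH.
  by rewrite setCU (subset_trans _ WF) // subsetIr.
apply/eqP; rewrite -eqSS -cW (cardsD1 v (~: W)) inE vW /= add1n eqSS.
by rewrite setDE setCU setIC.
Qed.
End Face.

Implicit Type BB : {set {set 'I_n}}.

Definition mnm_supp (m : 'X_{1..n}) : {set 'I_n} := [set v | m v != 0%N].

(** The Stanley-Reisner ideal of the complex with facets BB, described by its
    monomials. *)
Definition facet_ideal BB (p : S) :=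
  forall B, B \in BB -> forall m, mnm_supp m \subset B -> p@_m = 0.

Lemma facet_ideal_ideal BB : is_ideal (facet_ideal BB).
Proof.
split=> [B _ m _|p p' Ip Ip' B BB_B m mB|a p Ip B BB_B m mB]; first by rewrite mcoeff0.
  by rewrite mcoeffD (Ip B) // (Ip' B) // addr0.
rewrite mcoeffM big1 // => k /eqP mk; rewrite (Ip B) ?mulr0 //.
apply: subset_trans mB; apply/subsetP => v; rewrite !inE.
by move/mnmP/(_ v): mk; rewrite mnmDE => ->; rewrite addn_eq0 negb_and orbC => ->.
Qed.

Lemma mcoeffMX_eq0 (p : S) v (m : 'X_{1..n}) : m v = 0%N -> (p * 'X_v)@_m = 0.
Proof.
move=> mv; apply: memN_msupp_eq0; rewrite (perm_mem (msuppMX _ _)).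
apply/negP => /mapP[k _ mk]; move: mv; by rewrite mk mnmDE mnm1E eqxx.
Qed.

Lemma mnm_suppD1 (m : 'X_{1..n}) v : mnm_supp (U_(v) + m) = v |: mnm_supp m.
Proof.
apply/setP => w; rewrite !inE mnmDE mnm1E [v == w]eq_sym addn_eq0 negb_and.
by case: (w == v).
Qed.

Lemma mnm_decr (m : 'X_{1..n}) v : m v != 0%N -> exists m', m = (U_(v) + m')%MM.
Proof. by move=> mv; exists (m - U_(v))%MM; rewrite addmC submK // lep1mP. Qed.

(** The colon ideal belongs to the star of v, and the facets of the star are the
    bases that contain v. *)
Lemma facet_ideal_colon BB v :
  colon (facet_ideal BB) 'X_v = facet_ideal [set B in BB | v \in B].
Proof.
apply: ideal_ext => p; split=> Ip B.
  rewrite inE => /andP[BB_B vB] m mB; have := Ip B BB_B (U_(v) + m)%MM.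
  rewrite mulrC mcoeffMX; apply.
  by rewrite mnm_suppD1 subUset sub1set vB.
move=> BB_B m mB; rewrite mulrC; have [mv|mv] := eqVneq (m v) 0%N.
  exact: mcoeffMX_eq0.
have [m' mE] := mnm_decr mv; rewrite mE mnm_suppD1 subUset sub1set in mB *.
by case/andP: mB => vB mB; rewrite mcoeffMX (Ip B) // inE BB_B.
Qed.

Definition basis_exchange (T : finType) (XX : {set {set T}}) :=
  forall B1 B2, B1 \in XX -> B2 \in XX -> forall x, x \in B1 :\: B2 ->
    exists2 y, y \in B2 :\: B1 & y |: B1 :\ x \in XX.

(** Here exchange is needed: a face that avoids v but lies in a basis B
    containing v must also lie in a basis that avoids v, found by exchanging v
    against an element of a basis B0 that avoids it. *)
Lemma facet_ideal_delete BB v : basis_exchange BB ->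
  (exists2 B, B \in BB & v \notin B) ->
  add_gen (facet_ideal BB) 'X_v = facet_ideal [set B in BB | v \notin B].
Proof.
move=> exch [B0 BB_B0 vB0]; apply: ideal_ext => p; split.
  case=> a Ia B; rewrite inE => /andP[BB_B vB] m mB.
  have := Ia B BB_B m mB; rewrite mcoeffB mcoeffMX_eq0 ?subr0 //.
  by apply/eqP; apply: contraNT vB => mv; rewrite (subsetP mB) // inE.
move=> Ip.
(* Split p = p0 + a x_v, where p0 collects the monomials without x_v. *)
pose a : S := \sum_(m <- msupp p | m v != 0%N) p@_m *: 'X_[m - U_(v)].
have aE : a * 'X_v = \sum_(m <- msupp p | m v != 0%N) p@_m *: 'X_[m].
  rewrite mulr_suml; apply: eq_bigr => m mv.
  by rewrite -scalerAl -mpolyXD submK // lep1mP.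
have pE : p - a * 'X_v = \sum_(m <- msupp p | m v == 0%N) p@_m *: 'X_[m].
  rewrite {1}[p]mpolyE (bigID (fun m : 'X_{1..n} => m v == 0%N)) /= aE.
  by rewrite addrK.
exists a; rewrite pE; apply: ideal_sum => [|m /eqP mv]; first exact: facet_ideal_ideal.
move=> B BB_B m' mB; rewrite mcoeffZ mcoeffX.
case: eqP => [mm'|_]; last by rewrite mulr0.
rewrite -{}mm' in mB *; rewrite mulr1.
have [vB|vB] := boolP (v \in B); last by rewrite (Ip B) // inE BB_B.
have [|y] := exch B B0 BB_B BB_B0 v; first by rewrite !inE vB0.
rewrite !inE => /andP[yB yB0] BB_B'; apply: (Ip (y |: B :\ v)).
  by rewrite inE BB_B' !inE eqxx orbF; apply: contraNneq yB => <-.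
apply/subsetP => w mw; rewrite !inE (subsetP mB) // andbT.
by apply/orP; right; apply: contraTneq mw => ->; rewrite inE mv.
Qed.

Lemma facet_ideal_simplex F :
  facet_ideal [set F] =
  generated_by (fun v => if v \in F then z v else 'X_v) (~: F).
Proof.
set q := fun v => _; have iJ := generated_by_ideal q (~: F).
apply: ideal_ext => p; split=> [Ip|[c ->] B].
  rewrite [p]mpolyE big_seq; apply: ideal_sum => // m mp.
  have /subsetPn[v] : ~~ (mnm_supp m \subset F).
    apply: contraL mp => mF; rewrite mcoeff_msupp negbK.
    by rewrite (Ip F) ?set11.
  rewrite inE => /mnm_decr[m' ->] vF.
  rewrite -mul_mpolyC addmC mpolyXD mulrA; apply: ideal_mull => //.
  have -> : 'X_v = q v by rewrite /q (negPf vF).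
  by apply: generated_by_mem; rewrite inE.
rewrite inE => /eqP-> m mF; rewrite raddf_sum big1 // => v.
rewrite inE /q => vF; rewrite (negPf vF).
apply: mcoeffMX_eq0; apply/eqP; apply: contraNT vF => mv.
by rewrite (subsetP mF) // inE.
Qed.

(** Induction on the number of bases, splitting them at a v that belongs to
    some basis but not to all.  Both parts inherit the exchange property. *)
Theorem elem_sym_weakly_regular BB d :
  BB != set0 -> basis_exchange BB -> (forall B, B \in BB -> #|B| = d) ->
  weakly_regular (facet_ideal BB) (elem_sym_seq d).
Proof.
have [k] := ubnP #|BB|; elim: k BB => // k IH BB cBB BB0 exch cB.
have sub_exch (Q : pred {set 'I_n}) :
    (forall B1 B2 x y, B1 \in BB -> Q B1 -> B2 \in BB -> Q B2 ->
       x \in B1 :\: B2 -> y \in B2 :\: B1 -> Q (y |: B1 :\ x)) ->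
    basis_exchange [set B in BB | Q B].
  move=> HQ B1 B2; rewrite !inE => /andP[BB1 Q1] /andP[BB2 Q2] x xB.
  have [y yB BBy] := exch B1 B2 BB1 BB2 x xB; exists y => //.
  by rewrite inE BBy (HQ B1 B2).
have lt_card (Q : pred {set 'I_n}) B : B \in BB -> ~~ Q B ->
    (#|[set B in BB | Q B]| < k)%N.
  move=> BB_B QB; rewrite -ltnS (leq_trans _ cBB) // ltnS; apply: proper_card.
  apply/properP; split; first by apply/subsetP => C; rewrite inE => /andP[].
  by exists B => //; rewrite inE (negPf QB) andbF.
have [[v [B1 [B2 [BB1 BB2 v1 v2]]]]|novar] := pselect (exists v B1 B2,
  [/\ B1 \in BB, B2 \in BB, v \in B1 & v \notin B2]).
  apply: (@weakly_regular_extension _ _ 'X_v); first exact: facet_ideal_ideal.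
    rewrite facet_ideal_colon; apply: IH.
    - exact: lt_card BB2 v2.
    - by apply/set0Pn; exists B1; rewrite inE BB1.
    - apply: sub_exch => C1 C2 x y _ v1' _ v2'; rewrite !inE => /andP[xC _] _.
      by rewrite v1' andbT; apply/orP; right; apply: contraNneq xC => <-.
    - by move=> B; rewrite inE => /andP[/cB].
  rewrite facet_ideal_delete //; last by exists B2.
  apply: IH.
  - by apply: lt_card BB1 _; rewrite negbK.
  - by apply/set0Pn; exists B2; rewrite inE BB2.
  - apply: sub_exch => C1 C2 x y _ v1' _ v2' _; rewrite !inE => /andP[_ yC].
    rewrite (negPf v1') andbF orbF.
    by apply: contraNneq v2' => ->.
  - by move=> B; rewrite inE => /andP[/cB].
have [F BB_F] := set0Pn _ BB0.
have -> : BB = [set F].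
  apply/eqP; rewrite eqEsubset sub1set BB_F andbT; apply/subsetP => B BB_B.
  rewrite inE eqEsubset; apply/andP; split; apply/subsetP => v vB;
    apply/negPn/negP => vB'; apply: novar; first by exists v, B, F.
  by exists v, F, B.
rewrite facet_ideal_simplex; apply: weakly_regular_face; rewrite setCK //.
exact: cB.
Qed.
End ElementarySymmetric.

(** * Face rings of matroid complexes *)

(** Each exchange step makes B1 more similar to B2 without changing its size. *)
Lemma basis_exchange_card (T : finType) (XX : {set {set T}}) B1 B2 :
  basis_exchange XX -> B1 \in XX -> B2 \in XX -> #|B1| = #|B2|.
Proof.
move=> exch; have [k] := ubnP #|B1 :\: B2|; elim: k B1 => // k IH B1 ck XX1 XX2.
have [B12|[x xB]] := set_0Vmem (B1 :\: B2).
  have [B21|[x xB]] := set_0Vmem (B2 :\: B1).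
    congr (#|pred_of_set _|); apply/eqP; rewrite eqEsubset -!setD_eq0.
    by rewrite B12 B21 eqxx.
  by have [y] := exch B2 B1 XX2 XX1 x xB; rewrite B12 inE.
have [y yB XXy] := exch B1 B2 XX1 XX2 x xB.
move: (xB) (yB); rewrite !inE => /andP[xB2 xB1] /andP[yB1 yB2].
rewrite -(IH _ _ XXy XX2); last first.
  rewrite -ltnS (leq_trans _ ck) // ltnS; apply: proper_card; apply/properP; split.
    apply/subsetP => w; rewrite !inE => /andP[wB2].
    by case/orP=> [/eqP wy|/andP[_ ->]]; [rewrite wy yB2 in wB2 | rewrite wB2].
  by exists x => //; rewrite !inE eqxx orbF andbC; case: eqP xB2 => // ->; rewrite yB2.
by rewrite cardsU1 !inE (negPf yB1) andbF /= (cardsD1 x B1) xB1.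
Qed.

Lemma basis_exchange_imset (T U : finType) (f : T -> U) (XX : {set {set T}}) :
  injective f -> basis_exchange XX ->
  basis_exchange [set f @: (B : {set T}) | B in XX].
Proof.
move=> fI exch _ _ /imsetP[B1 XX1 ->] /imsetP[B2 XX2 ->] fx.
rewrite inE => /andP[fxB2 /imsetP[x xB1 fxE]]; rewrite {fx}fxE in fxB2 *.
have [|y] := exch B1 B2 XX1 XX2 x; first by rewrite inE xB1 -(mem_imset _ _ fI) fxB2.
rewrite inE => /andP[yB1 yB2] XXy; exists (f y).
  by rewrite inE !mem_imset // yB1.
apply/imsetP; exists (y |: B1 :\ x) => //.
rewrite imsetU1; congr (_ |: _); apply/setP => u; rewrite !inE.
apply/andP/imsetP => [[ux /imsetP[w wB1 uE]]|[w]]; last first.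
  by rewrite !inE => /andP[wx wB1] ->; rewrite (inj_eq fI) mem_imset.
by exists w; rewrite // !inE wB1 andbT; apply: contraNneq ux => <-; rewrite uE.
Qed.

Lemma generated_over_comp (A B C : comNzRingType) (f : {rmorphism A -> B})
    (h : {rmorphism B -> C}) l :
  (forall c, exists b, h b = c) -> generated_over f l ->
  generated_over (h \o f) (map h l).
Proof.
move=> hS gen P [P1 PB PM] Pf Pl c; have [b <-] := hS c.
apply: (gen (fun b => P (h b))) => [|a|x xl].
- split=> [|x y|x y]; rewrite ?rmorph1 ?rmorphB ?rmorphM //; [exact: PB|exact: PM].
- exact: Pf.
- by apply/Pl/map_f.
Qed.

Section MatroidFaceRing.
Variables (K : fieldType) (V : finType) (D : scomplex V) (BB : {set {set V}}).
Hypothesis faceE : forall F, face D F <-> exists2 B, B \in BB & F \subset B.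
Hypothesis exch : basis_exchange BB.
Local Notation S := {mpoly K[#|V|]}.
Local Notation R := (face_ring K D).

Let XX : {set {set 'I_#|V|}} := [set (@enum_rank V) @: (B : {set V}) | B in BB].

Lemma mpolyX_radical (m : 'X_{1..#|V|}) :
  exists a : S, 'X_[m] = a * sqfree_monomial K [set v | m (enum_rank v) != 0%N].
Proof.
exists (\prod_i 'X_i ^+ (m i).-1); rewrite mpolyXE_id /sqfree_monomial.
rewrite [X in _ * X](reindex (@enum_val _ V)) /=; last first.
  by exists enum_rank => v _; [exact: enum_valK | exact: enum_rankK].
rewrite [X in _ * X]big_mkcond -big_split; apply: eq_bigr => i _ /=.
rewrite inE enum_valK; case: (m i) => [|k] /=; first by rewrite mulr1.
by rewrite exprSr.
Qed.

Lemma SR_idealE (p : S) : ideal_gen (@nonface_monomial K V D) p <-> facet_ideal XX p.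
Proof.
split.
  apply: ideal_gen_sub; first exact: facet_ideal_ideal.
  move=> _ [F nF ->] _ /imsetP[B BB_B ->] m mB.
  have [FB|/subsetPn[v vF vB]] := boolP (F \subset B).
    by case: nF; apply/faceE; exists B.
  rewrite /sqfree_monomial (bigD1 v) //= mulrC mcoeffMX_eq0 //.
  apply/eqP; apply: contraNT vB => mv.
  by rewrite -(mem_imset _ _ enum_rank_inj) (subsetP mB) // inE.
move=> Ip; have iI := ideal_gen_ideal (@nonface_monomial K V D).
rewrite [p]mpolyE big_seq; apply: (ideal_sum _ iI) => m mp.
rewrite -mul_mpolyC; apply: (ideal_mull _ iI).
have [a ->] := mpolyX_radical m; apply: (ideal_mull _ iI).
apply: ideal_gen_mem; exists [set v | m (enum_rank v) != 0%N] => //.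
move=> /faceE[B BB_B mB]; move: mp; rewrite mcoeff_msupp (Ip (enum_rank @: B)) ?eqxx //.
  exact: imset_f.
apply/subsetP => i; rewrite inE => mi.
rewrite -[i]enum_valK mem_imset; last exact: enum_rank_inj.
by rewrite (subsetP mB) // inE enum_valK.
Qed.

Lemma face_ring_quotient : exists f : {rmorphism S -> R},
  (forall r, exists p, f p = r) /\ (fun p => f p = 0) = facet_ideal XX.
Proof.
pose f : {rmorphism S -> R} :=
  \pi_({ideal_quot (Idealr.clone _ (@SR_ideal K V D) _)})%qT.
exists f; split; first by move=> r; exists (repr r); rewrite /f /= reprK.
apply: ideal_ext => p; rewrite -SR_idealE -[0](rmorph0 f).
split=> [/eqP|Ip].
  by rewrite -Quotient.idealrBE subr0 => /asboolP.
by apply/eqP; rewrite -Quotient.idealrBE subr0; apply/asboolP.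
Qed.
End MatroidFaceRing.

Section CohenMacaulayQuotient.
Variables (K : fieldType) (n : nat) (BB : {set {set 'I_n}}) (d : nat).
Local Notation S := {mpoly K[n]}.
Hypothesis BB0 : BB != set0.
Hypothesis exch : basis_exchange BB.
Hypothesis BBd : forall B, B \in BB -> #|B| = d.

Lemma univariateM (p q : {poly K}) (v : 'I_n) :
  univariate (p * q) v = univariate p v * univariate q v.
Proof. by rewrite /univariate rmorphM hornerM. Qed.

(** Otherwise the variables outside P form a non-face, and their product would
    lie in the facet ideal, hence in P. *)
Lemma prime_contains_facet (P : S -> Prop) : prime_ideal P ->
  (forall p, facet_ideal BB p -> P p) ->
  exists2 B, B \in BB & forall v, v \notin B -> P 'X_v.
Proof.
move=> pP IP; apply: contrapT => noB.
pose F := [set v : 'I_n | `[< ~ P 'X_v >]].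
suff /IP /(prime_ideal_prod pP)[v] : facet_ideal BB (\prod_(v in F) 'X_v : S).
  by rewrite inE => /asboolP.
move=> B BB_B m mB.
have [v vB Pv] : exists2 v, v \notin B & ~ P 'X_v.
  apply: contrapT => noV; apply: noB; exists B => // v vB.
  by apply: contrapT => Pv; apply: noV; exists v.
have vF : v \in F by rewrite inE; apply/asboolP.
rewrite (bigD1 v) //= mulrC mcoeffMX_eq0 //.
by apply/eqP; apply: contraNT vB => mv; rewrite (subsetP mB) // inE.
Qed.

Variables (R : comNzRingType) (f : {rmorphism S -> R}).
Hypothesis f_surj : forall r, exists p, f p = r.
Hypothesis f_ker : (fun p => f p = 0) = facet_ideal BB.

Lemma quotient_generated :
  generated_over (f \o @mpolyC n K) [seq f 'X_i | i <- enum 'I_n].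
Proof.
have := generated_over_comp f_surj (@mpoly_generated K n).
by rewrite -map_comp.
Qed.

Lemma quotient_noetherian : noetherian R.
Proof.
exact: (@noetherian_generated K R (f \o @mpolyC n K) _ (@noetherian_field K)
  quotient_generated).
Qed.

Lemma quotient_chain_bound (P : R -> Prop) k C :
  prime_chain_to P k C -> (k <= d)%N.
Proof.
move=> [C1 C2 C3 C4].
have pC0 := preim_prime f (C1 0%N isT).
have [|B BB_B BC] := prime_contains_facet pC0.
  move=> p; rewrite -f_ker => ->; apply: ideal0.
  by case: (C1 0%N isT).
rewrite -(BBd BB_B); apply: (@prime_chain_bound K n k (fun i p => C i (f p))) => //.
- by move=> i /C1; apply: preim_prime.
- by move=> i ik p; apply: C2.
- move=> i ik; have [x] := C3 i ik; have [p <-] := f_surj x.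
  by exists p.
Qed.

Section Maximal.
Variable M : R -> Prop.
Hypothesis maxM : maximal_ideal M.

(** Apply [zariski_lemma] to the class of x_v in the residue field of M.  The
    extra factor X provides the root 0. *)
Lemma maximal_univariate v : exists g : {poly K},
  [/\ g \is monic, root g 0 & M (f (univariate g v))].
Proof.
have [L [h [h_surj h_ker]]] := residue_field maxM.
have gen := generated_over_comp h_surj quotient_generated.
have [P P0 Pv] := zariski_lemma (h (f 'X_v)) gen.
have PM : M (f (univariate P v)).
  apply/h_ker; rewrite -[RHS]Pv /univariate -[h (f _)]/((h \o f) _) -horner_map.
  by rewrite /= /horner_morph -map_poly_comp.
have [iM _ _] := maxM.
exists ('X * ((lead_coef P)^-1 *: P)); split.
- rewrite monicMl ?monicX // monicE lead_coefZ mulVf //.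
  by rewrite lead_coef_eq0.
- by rewrite rootM rootX eqxx.
- rewrite !univariateM rmorphM; apply: ideal_mull => //.
  rewrite -mul_polyC univariateM rmorphM; exact: ideal_mull.
Qed.

Lemma maximal_regular_seq : exists2 s, regular_seq_in M s & size s = d.
Proof.
have [g gP] := choice maximal_univariate.
have [iM M1 _] := maxM.
have wr : weakly_regular (fun p => f p = 0) (elem_sym_seq g d).
  rewrite f_ker; apply: elem_sym_weakly_regular => //.
  - by move=> v; case: (gP v).
  - by move=> v; case: (gP v).
have sM x : x \in map f (elem_sym_seq g d) -> M x.
  case/mapP=> p + ->.
  elim: d => //= k IH; rewrite inE => /orP[/eqP->|/IH //].
  rewrite rmorph_sum; apply: ideal_sum => // A /eqP cA.
  have /card_gt0P[v vA] : (0 < #|A|)%N by rewrite cA.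
  rewrite (bigD1 v) //= rmorphM; apply: ideal_mulr => //.
  by case: (gP v).
have sz : size (elem_sym_seq g d) = d by elim: d => //= k ->.
exists (map f (elem_sym_seq g d)); last by rewrite size_map.
split=> //; split.
  by move=> i; rewrite size_map => si; apply: weakly_regular_map.
by move=> /(ideal_gen_sub iM sM).
Qed.

(** Regular sequences in M give chains of primes, whose length is bounded by d;
    a sequence of length d shows that both bounds are attained. *)
Lemma maximal_depth_height : has_depth M d /\ has_height M d.
Proof.
have pM := maximal_is_prime maxM.
have chain s : regular_seq_in M s -> exists C, prime_chain_to M (size s) C.
  by move=> [[nz _] sM]; apply: regular_seq_chain.
have [s rs sz] := maximal_regular_seq.
split; split.
- by exists s.
- by move=> t /chain[C]; apply: quotient_chain_bound.
- by rewrite -sz; apply: chain.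
- by move=> k C; apply: quotient_chain_bound.
Qed.
End Maximal.

Lemma quotient_cohen_macaulay : cohen_macaulay R.
Proof.
split; first exact: quotient_noetherian.
by move=> M /maximal_depth_height[dM hM]; exists d.
Qed.
End CohenMacaulayQuotient.

Theorem matroid_face_ring_cohen_macaulay (K : fieldType) (V : finType)
    (D : scomplex V) (BB : {set {set V}}) :
  BB != set0 -> basis_exchange BB ->
  (forall F, face D F <-> exists2 B, B \in BB & F \subset B) ->
  cohen_macaulay (face_ring K D).
Proof.
move=> /set0Pn[B0 BB_B0] exch faceE.
have [f [f_surj f_ker]] := face_ring_quotient K faceE.
apply: (quotient_cohen_macaulay _ _ _ f_surj f_ker (d := #|B0|)).
- by apply/set0Pn; exists (enum_rank @: B0); apply: imset_f.
- exact: basis_exchange_imset enum_rank_inj exch.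
- move=> _ /imsetP[B BB_B ->]; rewrite (card_imset _ enum_rank_inj).
  exact: basis_exchange_card exch _ _.
Qed.

(** * Spanning trees *)

Section SpanningTrees.
Variables (V : finType) (G : connected_graph V).
Implicit Types (T S : {set edge G}) (e x y : edge G).

Lemma subadj_csym T : connect_sym (subadj T).
Proof. exact/sym_connect_sym/subadj_sym. Qed.

Lemma connect_sub_edges T S a b : T \subset S ->
  connect (subadj T) a b -> connect (subadj S) a b.
Proof.
move=> TS; apply: connect_sub => u v /existsP[e /andP[eT uv]].
by apply/connect1/existsP; exists e; rewrite (subsetP TS).
Qed.

Lemma connect_edge T e p q : e \in T -> val e = [set p; q] -> connect (subadj T) p q.
Proof. by move=> eT eE; apply/connect1/existsP; exists e; rewrite eT eE eqxx. Qed.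

Lemma edge_ends e : exists p q, p != q /\ val e = [set p; q].
Proof.
have := valP e; rewrite inE => /existsP[p /existsP[q /andP[pq /eqP->]]].
by exists p, q; split=> //; apply: contraTneq pq => ->; rewrite adj_irrefl.
Qed.

Lemma edge_neq e p q : val e = [set p; q] -> p != q.
Proof.
have [a [b [ab ->]]] := edge_ends e => E.
have := cards2 a b; rewrite E cards2 ab; case: (p != q) => //.
Qed.

Lemma set2_eqP (T : finType) (a b c d : T) : [set a; b] = [set c; d] ->
  (a = c /\ b = d) \/ (a = d /\ b = c).
Proof.
move=> E; have /set2P ha : a \in [set c; d] by rewrite -E set21.
have /set2P hb : b \in [set c; d] by rewrite -E set22.
have /set2P hc : c \in [set a; b] by rewrite E set21.
have /set2P hd : d \in [set a; b] by rewrite E set22.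
by intuition congruence.
Qed.

(** A path using the new edge can be cut at it. *)
Lemma connect_setU1 T e a b p q : val e = [set a; b] ->
  connect (subadj (e |: T)) p q ->
  [\/ connect (subadj T) p q,
      connect (subadj T) p a /\ connect (subadj T) b q |
      connect (subadj T) p b /\ connect (subadj T) a q].
Proof.
move=> eE /connectP[s + ->]; elim/last_ind: s => [|s r IH].
  by move=> _; apply: Or31.
rewrite rcons_path last_rcons => /andP[/IH{}IH].
move: (last p s) IH => u IH /existsP[y /andP[]].
rewrite in_setU1 => /orP[/eqP->|yT] /eqP yE; last first.
  have ur := connect_edge yT yE; case: IH => [pu|[pa bu]|[pb au]].
  - by apply: Or31; apply: connect_trans ur.
  - by apply: Or32; split=> //; apply: connect_trans ur.
  - by apply: Or33; split=> //; apply: connect_trans ur.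
rewrite eE in yE; case: (set2_eqP yE) => -[<- <-] in IH *.
  case: IH => [pa|[pa ba]|[pb aa]].
  - by apply: Or32.
  - by apply: Or32.
  - by apply: Or31.
case: IH => [pb|[pa bb]|[pb ab]].
- by apply: Or33.
- by apply: Or31.
- by apply: Or33.
Qed.

(** A path between the ends of e that avoids e can be made simple, and then
    closes up with e to a cycle. *)
Lemma acyclic_isthmus T e p q : acyclic T -> e \in T -> val e = [set p; q] ->
  ~ connect (subadj (T :\ e)) p q.
Proof.
move=> acT eT eE /connectP[s0 /shortenP[s ps us _] qE].
apply: (acT (p :: s)).
  case: s ps us qE => [|r [|t s]] //=; rewrite ?andbT => ps us qE.
    by have := edge_neq eE; rewrite qE eqxx.
  move: ps; rewrite -qE => /existsP[e' /andP[]]; rewrite !inE => /andP[e'e _].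
  by rewrite -eE (inj_eq val_inj) (negPf e'e).
rewrite /ucycle us andbT /= rcons_path; apply/andP; split.
  apply: sub_path ps => u v /existsP[e' /andP[]]; rewrite !inE => /andP[_ e'T] uv.
  by apply/existsP; exists e'; rewrite e'T.
by apply/existsP; exists e; rewrite eT -qE setUC eE eqxx.
Qed.

(** A spanning set of isthmuses is minimal among the spanning sets. *)
Lemma isthmus_acyclic T : spans T ->
  (forall e p q, e \in T -> val e = [set p; q] -> ~ connect (subadj (T :\ e)) p q) ->
  acyclic T.
Proof.
move=> spT isT; apply: minset_acyclic; apply/minsetP; split=> // S spS ST.
apply/eqP; rewrite eqEsubset ST; apply/subsetP => e eT; apply/negPn/negP => eS.
have [p [q [_ eE]]] := edge_ends e; apply: (isT e p q eT eE).
apply: (@connect_sub_edges S); last exact: (forallP (forallP spS p) q).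
by rewrite subsetD1 ST.
Qed.

Lemma connect_crossing (r : rel V) (C : pred V) a b :
  connect r a b -> C a -> ~~ C b -> exists c d, [/\ r c d, C c & ~~ C d].
Proof.
move=> /connectP[s + ->]; elim: s a => [|u s IH] a /=; first by move=> _ ->.
move=> /andP[au ps] Ca Cb; have [Cu|Cu] := boolP (C u); first exact: IH Cu Cb.
by exists a, u.
Qed.

Definition spanning_trees : {set {set edge G}} := [set T | `[< spanning_tree T >]].

(** Removing x = {a, b} from T1 leaves two components.  A path of T2 from a to b
    crosses from one to the other along an edge y, and y joins the components
    again.  Every edge e of the new set is an isthmus: a path between its ends
    that avoids e must use y if it is not already in T1, and then e would
    connect the ends of y without y. *)
Lemma spanning_tree_exchange : basis_exchange spanning_trees.
Proof.
move=> T1 T2; rewrite !inE => /asboolP[sp1 ac1] /asboolP[sp2 ac2] x.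
rewrite inE => /andP[xT2 xT1].
have [a [b [_ xE]]] := edge_ends x; set S := T1 :\ x.
have abS := acyclic_isthmus ac1 xT1 xE.
have [c [d [/existsP[y /andP[yT2 /eqP yE]] ac ad]]] :=
  connect_crossing (C := connect (subadj S) a)
    (forallP (forallP sp2 a) b) (connect0 _ _) (introN idP abS).
have cdS : ~ connect (subadj S) c d.
  by move=> cd; case/negP: ad; apply: connect_trans cd.
have yS : y \notin S by apply/negP => yS; apply/cdS/(connect_edge yS).
have yx : y != x by apply: contraNneq xT2 => <-.
have yT1 : y \notin T1 by move: yS; rewrite !inE yx.
exists y; first by rewrite inE yT1.
rewrite inE; apply/asboolP; rewrite -/S; set T := y |: S.
have csym := subadj_csym.
have ST : S \subset T by apply: subsetUr.
(* Without x, every vertex is joined to a or to b. *)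
have cross w : connect (subadj S) a w \/ connect (subadj S) b w.
  have : connect (subadj (x |: S)) a w.
    by rewrite setD1K //; apply: (forallP (forallP sp1 a)).
  by case/(connect_setU1 xE) => [|[]|[/abS]]; auto.
have bd : connect (subadj S) b d.
  by case: (cross d) => // add; rewrite add in ad.
have aT w : connect (subadj T) a w.
  have [/(connect_sub_edges ST) //|/(connect_sub_edges ST)] := cross w.
  apply: connect_trans; apply: (connect_trans (connect_sub_edges ST ac)).
  apply: (@connect_trans _ _ d).
    by apply: (connect_edge _ yE); apply: setU11.
  by rewrite csym; apply: (connect_sub_edges ST).
have spT : spans T.
  apply/forallP=> u; apply/forallP=> w; apply: (connect_trans _ (aT w)).
  by rewrite csym.
split=> //; apply: isthmus_acyclic => // e p q; rewrite in_setU1.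
have [-> _ yE'|ey /= eS eE] := eqVneq e y.
  rewrite setU1K // => pq; apply: cdS; rewrite yE in yE'.
  by case: (set2_eqP yE') => -[-> ->] //; rewrite csym.
have -> : T :\ e = y |: (S :\ e).
  by apply/setP => w; rewrite !inE; have [->|] := eqVneq w y; rewrite //= eq_sym ey.
have SeS : S :\ e \subset S by apply: subD1set.
have pqS := connect_edge eS eE.
have eT1 : e \in T1 by move: eS; rewrite inE => /andP[].
case/(connect_setU1 yE) => [pq|[pc dq]|[pd cq]].
- apply: (acyclic_isthmus ac1 eT1 eE); apply: connect_sub_edges pq.
  exact/setSD/subD1set.
- apply: cdS; apply: (@connect_trans _ _ p); first
    by rewrite csym; apply: connect_sub_edges pc.
  by apply: (connect_trans pqS); rewrite csym; apply: connect_sub_edges dq.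
- apply: cdS; apply: (@connect_trans _ _ q); first by apply: connect_sub_edges cq.
  rewrite csym; apply: (connect_trans _ pqS).
  by rewrite csym; apply: connect_sub_edges pd.
Qed.

Theorem spanning_complex_cohen_macaulay (K : fieldType) :
  cohen_macaulay (face_ring K (spanning_complex G)).
Proof.
apply: (@matroid_face_ring_cohen_macaulay K _ _ spanning_trees).
- have [T tT _] := spanning_face0 G.
  by apply/set0Pn; exists T; rewrite inE; apply/asboolP.
- exact: spanning_tree_exchange.
- move=> F; split=> -[T tT FT]; exists T => //; first by rewrite inE; apply/asboolP.
  by move: tT; rewrite inE => /asboolP.
Qed.
End SpanningTrees.

Theorem theorem4p4 (m : nat) (hm : (3 <= m)%N) (K : fieldType) :
  cohen_macaulay (face_ring K (spanning_complex (jahangir m))).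
Proof. exact: spanning_complex_cohen_macaulay. Qed.
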